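(* Consider any $g\in\mathcal G$. There exist constants $c_1(g),c_2(g)>0$ only depending on $g$ such that the following holds for all $n\ge c_1(g)$ and $\alpha\in(0,0.5)$. Consider an integer $k\le0.1\,n$ such that $$\eta=c_2(g)\big((k/n)\vee n^{-1/6}\big)\max_{t\in[0.95\alpha/n,\,\alpha]}\left\{\frac1{\overline G^{-1}(t/2)-\overline G^{-1}(t)}\,\frac{g(\overline G^{-1}(t))}{g(\overline G^{-1}(t/2))}\right\}\le0.05 .$$ Then, with $\widetilde\theta=Y_{(\lceil n/2\rceil)}$, $$\mathbf I_g(\mathrm{BH}_\alpha(\widetilde\theta),k)\le\alpha(1+\eta)+e^{-n^{1/2}},$$ $$\mathbf{II}_g(\mathrm{BH}_\alpha(\widetilde\theta),k,\alpha(1-\eta))\le e^{-n^{1/2}} .$$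
   Context: Notation: $x\vee y=\max(x,y)$; $Y_{(i)}$ is the $i$-th smallest entry of $Y$. $\mathcal G$ is the collection of probability densities on $\mathbb R$ that are symmetric (about $0$), continuous, and non-increasing on $\mathbb R_+$. For $g\in\mathcal G$, $\overline G(y)=\int_y^{+\infty}g(x)\,dx$ and $\overline G^{-1}(q)$, $q\in(0,1)$, is the inverse function of $\overline G$. Setting. One observes $Y=(Y_1,\dots,Y_n)$ with independent real coordinates, $Y_i\sim P_i$, and $P=\otimes_{i=1}^nP_i$. $\mathcal P_g$ is the set of all such product distributions $P$ on $\mathbb R^n$ for which there exists $\theta\in\mathbb R$ with $|\{i: P_i\text{ has density }g(\cdot-\theta)\}|>n/2$; this $\theta$ is unique and denoted $\theta(P)$. Let $\mathcal H_0(P)=\{i: P_i\text{ has density }g(\cdot-\theta(P))\}$ (true nulls), $\mathcal H_1(P)$ its complement in $\{1,\dots,n\}$, $n_1(P)=|\mathcal H_1(P)|$. A multiple testing procedure is a measurable map $R$ from the data $Y$ to subsets $R(Y)\subset\{1,\dots,n\}$. Set $$\mathrm{FDP}(P,R(Y))=\frac{|R(Y)\cap\mathcal H_0(P)|}{|R(Y)|\vee1},\quad \mathrm{FDR}(P,R)=\mathbb E_{Y\sim P}[\mathrm{FDP}(P,R(Y))],\quad \mathrm{TDP}(P,R(Y))=\frac{|R(Y)\cap\mathcal H_1(P)|}{n_1(P)\vee1}.$$ BH. For $u\in\mathbb R$ let $p_i(u)=2\overline G(|Y_i-u|)$, $T_\alpha(u)=\max\{t\in[0,1]:\sum_{i=1}^n\mathbf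 1\{p_i(u)\le t\}\ge nt/\alpha\}$ and $\mathrm{BH}_\alpha(u)=\{i: p_i(u)\le T_\alpha(u)\}$. The oracle is $\mathrm{BH}^*_\alpha=\mathrm{BH}_\alpha(\theta(P))$. Risks: $\mathbf I_g(R,k)=\sup_{P\in\mathcal P_g,\,n_1(P)\le k}\mathrm{FDR}(P,R)$ and $\mathbf{II}_g(R,k,\alpha)=\sup_{P\in\mathcal P_g,\,n_1(P)\le k}\mathbb P_{Y\sim P}\big(\mathrm{TDP}(P,R)<\mathrm{TDP}(P,\mathrm{BH}^*_\alpha)\big)$. *)

(* Defs.v *)
From HB Require Import structures.
From mathcomp Require Import all_boot all_order all_algebra.
From mathcomp Require Import all_classical all_reals all_analysis.

Set Implicit Arguments.
Unset Strict Implicit.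
Unset Printing Implicit Defensive.

Import Order.TTheory GRing.Theory Num.Theory.
Import numFieldNormedType.Exports.

Local Open Scope classical_set_scope.
Local Open Scope ring_scope.

Section Densities.
Context {R : realType}.
Implicit Types (g : R -> R).

Definition is_density g : Prop :=
  [/\ measurable_fun setT g, forall x, 0 <= g x &
      (\int[lebesgue_measure]_x (g x)%:E = 1)%E].

Definition symmetric_unimodal_density g : Prop :=
  [/\ is_density g, forall x, g (- x) = g x, continuous g &
      forall x y, 0 <= x -> x <= y -> g y <= g x].

Definition Gbar g (y : R) : R := \int[lebesgue_measure]_(x in `[y, +oo[) g x.

(* For g symmetric, continuous and non-increasing on R_+, and q in ]0, 1[, the
   equation Gbar g y = q has exactly one solution: g > 0 wherever
   0 < Gbar g < 1.  Outside ]0, 1[ the value is irrelevant. *)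
Definition Gbar_inv g (q : R) : R := get [set y | Gbar g y = q].

Definition has_density (mu : set R -> \bar R) (f : R -> R) : Prop :=
  forall A : set R, measurable A ->
    mu A = (\int[lebesgue_measure]_(x in A) (f x)%:E)%E.

End Densities.

Section Model.
Context {R : realType} {n : nat}.

(* [n.-tuple R] carries the product sigma-algebra. *)
Implicit Types (P : probability (n.-tuple R) R) (g : R -> R).

Definition marginal P (i : 'I_n) : set R -> \bar R :=
  pushforward P (fun y : n.-tuple R => tnth y i).

(* P is the product of its marginals: the coordinates are independent.  A
   probability on the product sigma-algebra is determined by its values on
   rectangles. *)
Definition is_product P : Prop :=
  forall A : 'I_n -> set R, (forall i, measurable (A i)) ->
    P [set y | forall i, A i (tnth y i)] = (\prod_(i < n) marginal P i (A i))%E.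

Definition nulls_at g P (theta : R) : {set 'I_n} :=
  [set i | `[< has_density (marginal P i) (fun x => g (x - theta)) >]]%SET.

Definition majority_at g P (theta : R) : Prop :=
  (n < 2 * #|nulls_at g P theta|)%N.

Definition in_Pg g P : Prop :=
  is_product P /\ exists theta, majority_at g P theta.

(* Unique as soon as it exists: a strict majority is required, and distinct
   translates of an integrable function are distinct distributions. *)
Definition theta g P : R := get [set t | majority_at g P t].

Definition H0 g P : {set 'I_n} := nulls_at g P (theta g P).
Definition H1 g P : {set 'I_n} := (~: H0 g P)%SET.
Definition n1 g P : nat := #|H1 g P|.

(* Measurability of a procedure is not bundled: [FDR], [risk_I] and [risk_II]
   are only meaningful for maps whose level sets are measurable, as is the
   case for [BH] centered at a measurable statistic. *)
Definition procedure : Type := n.-tuple R -> {set 'I_n}.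
Implicit Types (phi : procedure).

Definition FDP g P (S : {set 'I_n}) : R :=
  #|(S :&: H0 g P)%SET|%:R / (maxn #|S| 1)%:R.

Definition TDP g P (S : {set 'I_n}) : R :=
  #|(S :&: H1 g P)%SET|%:R / (maxn (n1 g P) 1)%:R.

Definition FDR g P phi : \bar R := 'E_P[fun y => FDP g P (phi y)].

Definition pval g (u : R) (y : n.-tuple R) (i : 'I_n) : R :=
  2 * Gbar g `|tnth y i - u|.

(* The set is nonempty (it contains 0), bounded, and closed under increasing
   limits, so the supremum is a maximum. *)
Definition BH_threshold g (alpha u : R) (y : n.-tuple R) : R :=
  sup [set t | 0 <= t <= 1 /\
               n%:R * t / alpha <= \sum_(i < n) ((pval g u y i <= t)%R : nat)%:R].

(* The centering [u] may depend on the observation; the oracle uses a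
   constant. *)
Definition BH g (alpha : R) (u : n.-tuple R -> R) : procedure :=
  fun y => [set i | pval g (u y) y i <= BH_threshold g alpha (u y) y]%SET.

Definition BH_oracle g P (alpha : R) : procedure :=
  BH g alpha (fun=> theta g P).

Definition risk_I g phi (k : nat) : \bar R :=
  ereal_sup [set FDR g P phi | P in [set P | in_Pg g P /\ (n1 g P <= k)%N]].

Definition risk_II g phi (k : nat) (alpha : R) : \bar R :=
  ereal_sup
    [set P [set y | TDP g P (phi y) < TDP g P (BH_oracle g P alpha y)]
    | P in [set P | in_Pg g P /\ (n1 g P <= k)%N]].

(* 1-indexed: the j-th smallest entry, for 1 <= j <= n. *)
Definition order_stat (j : nat) (y : n.-tuple R) : R :=
  nth 0 (sort <=%R y) j.-1.

(* uphalf n is the ceiling of n / 2. *)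
Definition sample_median : n.-tuple R -> R := order_stat (uphalf n).

End Model.

Arguments procedure : clear implicits.

(* For 0 < alpha < 1/2 and n >= 1 the function of t is continuous on the
   compact interval, so the supremum is a maximum. *)
Definition eta_of {R : realType} (c2 : R) (g : R -> R) (n k : nat) (alpha : R)
  : R :=
  c2 * Num.max (k%:R / n%:R) (n%:R `^ (- (1 / 6)))
  * sup [set 1 / (Gbar_inv g (t / 2) - Gbar_inv g t)
             * (g (Gbar_inv g t) / g (Gbar_inv g (t / 2)))
        | t in `[95 / 100 * alpha / n%:R, alpha]].

(* Main.v *)
Require Import Defs.
From mathcomp Require Import all_boot all_order all_algebra.
From mathcomp Require Import all_classical all_reals all_analysis.
From mathcomp Require Import measurable_realfun ring lra zify.
Set Implicit Arguments.
Unset Strict Implicit.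
Unset Printing Implicit Defensive.
Import Order.TTheory GRing.Theory Num.Theory.
Import numFieldNormedType.Exports.
Local Open Scope classical_set_scope.
Local Open Scope ring_scope.

(** The proof compares the procedure centered at the median with the one centered
    at the true location [theta], on the event that the two centers are within
    [d = c2 * max (k / n, n^(-1/6))] of each other.

    That event has probability at least [1 - exp (- n^(1/2))]
    ([median_concentrates]).  A median off by more than [d] leaves at most [n / 2]
    nulls in a half-line that contains each null with probability
    [1 - Gbar g d >= 1 / 2 + 5 / 4 * max (k / n, n^(-1/6))]; the gain over [1 / 2]
    pays for the [k] non-nulls and leaves room for a Chernoff bound with exponent
    of order [n^(2/3)].

    On that event, a p-value at most [t] for one center is at most [t * (1 + eta)]
    for the other, for all [t] between [95 / 100 * alpha / n] and [alpha]
    ([pvalue_shift]).  Indeed let [y < x] be the upper quantiles of orders [t] and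
    [t / 2].  Moving [x] inwards by [d <= x - y] adds at most [d * g y] to the tail
    [t / 2], which itself is the mass of the interval from [y] to [x] and so is at
    least [(x - y) * g x]; the ratio is the expression maximized in [eta_of].

    Power then follows deterministically: a relative error [eta] on the p-values
    is absorbed by a change of level from [alpha * (1 - eta)] to [alpha]
    ([rejected_subset]), so the oracle rejects a subset ([oracle_subset]).

    The false discovery proportion is not monotone in the rejections, so its bound
    needs independence.  When a null [i] is rejected along with [r] hypotheses in
    total, replacing [Y_i] by a fixed very extreme value on the same side of the
    median changes neither the median nor the rejection set
    ([rejection_decouples]).  Hence the event lies in the intersection of
    an event on the other coordinates and of a tail event on [Y_i], of probability
    at most [alpha * r / (2 * n) * (1 + eta)].  In the sum of [1 / r] times these
    probabilities the factor [r] cancels, the events on the other coordinates are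
    disjoint in [r], and there are two sides and at most [n] nulls: the total is
    at most [alpha * (1 + eta)] ([FDR_bound]). *)

(** * Tails of a symmetric unimodal density *)

Section Tail.
Context {R : realType} (g : R -> R).
Hypothesis hg : symmetric_unimodal_density g.
Local Notation mu := (@lebesgue_measure R).
Local Notation G := (Gbar g).

Let g_ge0 x : 0 <= g x. Proof. by case: hg => -[]. Qed.
Let gN x : g (- x) = g x. Proof. by case: hg. Qed.
Let g_cont : continuous g. Proof. by case: hg. Qed.
Let g_decr x y : 0 <= x -> x <= y -> g y <= g x.
Proof. by case: hg => _ _ _; apply. Qed.
Let g_meas (A : set R) : measurable_fun A (EFin \o g).
Proof. by have [[mg _ _] _ _ _] := hg; apply/measurable_EFinP/measurable_funTS. Qed.

#[local] Hint Extern 0 (measurable_fun _ _) => solve [exact: g_meas] : core.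

Lemma density_le_mode x : g x <= g 0.
Proof.
have [x0|x0] := leP 0 x; first exact: g_decr.
by rewrite -gN; apply: g_decr => //; rewrite oppr_ge0 ltW.
Qed.

Lemma integral_tail a : (\int[mu]_(x in `[a, +oo[) (g x)%:E = (G a)%:E)%E.
Proof.
rewrite /Gbar /Rintegral fineK// ge0_fin_numE; last first.
  by apply: integral_ge0 => x _; rewrite lee_fin.
apply: (@le_lt_trans _ _ (\int[mu]_x (g x)%:E)%E).
  by apply: ge0_subset_integral => //= x _; rewrite lee_fin.
by case: hg => -[_ _ ->] _ _ _; rewrite ltry.
Qed.

Lemma Gbar_ge0 a : 0 <= G a.
Proof.
by rewrite -lee_fin -integral_tail; apply: integral_ge0 => x _; rewrite lee_fin.
Qed.

Lemma Gbar0 : G 0 = 1 / 2.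
Proof.
have := ge0_symfun_integralT g_ge0 g_cont (fun x => esym (gN x)).
have -> : [set x : R | 0 <= x] = `[0, +oo[%classic.
  by apply/seteqP; split => x /=; rewrite in_itv/= andbT.
rewrite integral_tail; case: hg => -[_ _ ->] _ _ _.
by rewrite -EFinM => -[] h; lra.
Qed.

(** The drop of the tail between [a] and [b] is the mass of the interval, which
    bounds on the density there control. *)
Lemma Gbar_drop_bounds a b m M : a <= b -> 0 <= m ->
  (forall x, a <= x -> x <= b -> m <= g x <= M) ->
  (b - a) * m <= G a - G b <= (b - a) * M.
Proof.
move=> ab m0 gmM.
have M0 : 0 <= M by have /andP[_ h] := gmM a (lexx _) ab; apply: le_trans h.
have := integral_tail a.
rewrite (@itv_bndbnd_setU _ _ _ (BLeft b))//= ?bnd_simp//.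
rewrite ge0_integral_setU//; first last.
- by apply/disj_setPS => x []/=; rewrite !in_itv/= andbT => /andP[_]; lra.
- by move=> x _; rewrite lee_fin.
rewrite integral_tail => H.
have mub : mu `[a, b[%classic = (b - a)%:E.
  rewrite lebesgue_measure_itv/= lte_fin; move: ab; rewrite le_eqVlt.
  by case/predU1P => [->|->]; rewrite ?ltxx ?subrr// EFinB.
have int_cst c : (\int[mu]_(x in `[a, b[) (cst c%:E) x = ((b - a) * c)%:E)%E.
  by rewrite integral_cst// [X in (_ * X)%E]mub -EFinM mulrC.
have lo : (((b - a) * m)%:E <= \int[mu]_(x in `[a, b[) (g x)%:E)%E.
  rewrite -int_cst; apply: ge0_le_integral => //= x.
  by rewrite in_itv/= lee_fin => /andP[ax xb]; have /andP[] := gmM x ax (ltW xb).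
have hi : (\int[mu]_(x in `[a, b[) (g x)%:E <= ((b - a) * M)%:E)%E.
  rewrite -int_cst; apply: ge0_le_integral => //= x; first by rewrite lee_fin.
  by rewrite in_itv/= lee_fin => /andP[ax xb]; have /andP[] := gmM x ax (ltW xb).
have conclude I : (((b - a) * m)%:E <= I)%E -> (I <= ((b - a) * M)%:E)%E ->
    (I + (G b)%:E = (G a)%:E)%E -> (b - a) * m <= G a - G b <= (b - a) * M.
  case: I => [r||]//=; rewrite !lee_fin -EFinD => mr rM -[<-].
  by rewrite addrK mr.
exact: conclude lo hi H.
Qed.

Lemma Gbar_anti a b : a <= b -> G b <= G a.
Proof.
move=> ab; rewrite -subr_ge0.
have /andP[+ _] := @Gbar_drop_bounds a b 0 (g 0) ab (lexx _)
  (fun x _ _ => introT andP (conj (g_ge0 x) (density_le_mode x))).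
by rewrite mulr0.
Qed.

Lemma Gbar_drop a b : 0 <= a -> a <= b -> (b - a) * g b <= G a - G b <= (b - a) * g a.
Proof.
move=> a0 ab; apply: Gbar_drop_bounds => // x ax xb.
by rewrite !g_decr//; exact: le_trans ax.
Qed.

(** The tail is Lipschitz because the density is bounded by its value at the mode. *)
Lemma continuous_Gbar : continuous G.
Proof.
have lip a b : a <= b -> `|G a - G b| <= (g 0 + 1) * `|a - b|.
  move=> ab.
  have /andP[_ h] := @Gbar_drop_bounds a b 0 (g 0) ab (lexx _)
    (fun x _ _ => introT andP (conj (g_ge0 x) (density_le_mode x))).
  rewrite ger0_norm ?subr_ge0 ?Gbar_anti// distrC ger0_norm ?subr_ge0//.
  by rewrite (le_trans h)// mulrC ler_wpM2r ?subr_ge0 ?lerDl.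
(* Adding [1] makes the Lipschitz constant positive. *)
have K0 : 0 < g 0 + 1 by rewrite ltr_wpDl.
move=> a; apply/cvgrPdist_lt => e e0.
near=> b.
have h : `|G a - G b| <= (g 0 + 1) * `|a - b|.
  by have [/lip//|/ltW/lip] := leP a b; rewrite distrC (distrC b).
rewrite (le_lt_trans h)// mulrC -ltr_pdivlMr//.
by near: b; apply: cvgr_dist_lt => //; apply: divr_gt0.
Unshelve. all: by end_near. Qed.

Lemma measurable_Gbar : measurable_fun setT G.
Proof. exact: continuous_measurable_fun continuous_Gbar. Qed.

Lemma Gbar_small q : 0 < q -> exists2 x, 0 <= x & G x < q.
Proof.
move=> q0; have [[mg _ _] _ _ _] := hg.
have cv := @ge0_cvgn_integral R mu g g_ge0 mg.
have E (n : nat) : (\int[mu]_(x in `[0%R, n%:R]) (g x)%:E = (G 0 - G n%:R)%:E)%E.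
  have := integral_tail 0.
  rewrite (@itv_bndbnd_setU _ _ _ (BRight n%:R))//= ?bnd_simp//.
  rewrite ge0_integral_setU//; first last.
  - by apply/disj_setPS => x []/=; rewrite !in_itv/= andbT => /andP[_]; lra.
  - by move=> x _; rewrite lee_fin.
  rewrite integral_itv_obnd_cbnd// integral_tail.
  have conclude I : (I + (G n%:R)%:E = (G 0)%:E)%E -> I = (G 0 - G n%:R)%:E.
    by case: I => [r||]//=; rewrite -EFinD => -[<-]; rewrite addrK.
  exact: conclude.
have {}cv : (G 0 - G n%:R) @[n --> \oo] --> G 0.
  move: cv; rewrite integral_tail; under eq_fun do rewrite E.
  by move/fine_cvg.
have /cvgrPdist_lt/(_ q q0)[n _ /(_ n (leqnn _))/=] := cv.
rewrite opprB addrC subrK ger0_norm ?Gbar_ge0// => h.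
by exists n%:R.
Qed.

Lemma Gbar_invK q : 0 < q -> q <= 1 / 2 -> G (Gbar_inv g q) = q.
Proof.
move=> q0 q1; have [x x0 xq] := Gbar_small q0.
have [||y _ yq] := @IVT R G 0 x q x0.
- exact/continuous_subspaceT/continuous_Gbar.
- by rewrite Gbar0 ge_min (ltW xq) orbT le_max q1.
by rewrite /Gbar_inv; apply: (@getPex _ [set y | G y = q]); exists y.
Qed.

Lemma Gbar_inv_ge0 q : 0 < q -> q < 1 / 2 -> 0 <= Gbar_inv g q.
Proof.
move=> q0 q1; rewrite leNgt; apply/negP => /ltW/Gbar_anti.
by rewrite Gbar_invK ?(ltW q1)// Gbar0; lra.
Qed.

(** By monotonicity, a zero of the density at [x >= 0] would empty the half-line
    beyond [x]. *)
Lemma density_gt0 x : 0 <= x -> 0 < G x -> 0 < g x.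
Proof.
move=> x0 Gx; rewrite lt0r g_ge0 andbT; apply/negP => /eqP gx0.
have [y y0 yG] := Gbar_small Gx.
have xy : x <= y by rewrite leNgt; apply/negP => /ltW/Gbar_anti; rewrite leNgt yG.
have /andP[_] := Gbar_drop x0 xy; rewrite gx0 mulr0; lra.
Qed.

Lemma Gbar_lt a b : 0 <= a -> a < b -> 0 < G b -> G b < G a.
Proof.
move=> a0 ab Gb; have /andP[h _] := Gbar_drop a0 (ltW ab).
rewrite -subr_gt0; apply: lt_le_trans h.
by rewrite mulr_gt0 ?subr_gt0 ?density_gt0// (le_trans a0) ?ltW.
Qed.

(** Comparing a p-value with a level amounts to comparing a distance with a
    quantile, also where the tail vanishes and is not injective. *)
Lemma Gbar_le_inv a q : 0 <= a -> 0 < q -> q <= 1 / 2 -> G a <= q -> Gbar_inv g q <= a.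
Proof.
move=> a0 q0 q1 Ga; rewrite leNgt; apply/negP => h.
by have := Gbar_lt a0 h; rewrite Gbar_invK// => /(_ q0); rewrite ltNge Ga.
Qed.

Lemma integral_shifted_tail a t :
  (\int[mu]_(x in `[a, +oo[) (g (x - t))%:E = (G (a - t))%:E)%E.
Proof.
rewrite -integral_tail.
have D (x : R) : is_derive x (1 : R) (fun x : R => x - t) (1 : R).
  by rewrite -[X in is_derive _ _ _ X]subr0; apply: is_deriveB.
have D1 : derive1 (fun x : R => x - t) = cst 1.
  by apply/funext => x; rewrite derive1E derive_val.
rewrite (@increasing_ge0_integration_by_substitutiony R (fun x => x - t) g a)//.
- by apply: eq_integral => x _; rewrite D1 /= mulr1.
- by move=> x y _ _; rewrite ltrD2r.
- by rewrite D1 => x _; exact: cst_continuous.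
- by rewrite D1; exact: is_cvg_cst.
- by rewrite D1; exact: is_cvg_cst.
- split=> [x _|]; first by [].
  by apply: cvg_at_right_filter; apply: cvgB => //; exact: cvg_cst.
- exact: (@cvg_addrr _ (- t)).
- exact/continuous_subspaceT.
Qed.

Lemma GbarN a : G (- a) = 1 - G a.
Proof.
have [[_ _ mass1] _ _ _] := hg.
have half : (\int[mu]_(x in `]-oo, (- a)%R]) (g x)%:E = (G a)%:E)%E.
  rewrite ge0_integration_by_substitutionNy//; last exact: continuous_subspaceT.
  by rewrite -integral_tail; apply: eq_integral => x _ /=; rewrite gN.
move: mass1; rewrite -set_itvNyy (@itv_bndbnd_setU _ _ _ (BLeft (- a)))//.
rewrite ge0_integral_setU//; first last.
- by apply/disj_setPS => x []/=; rewrite !in_itv/= andbT => ?; lra.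
- by move=> x _; rewrite lee_fin.
rewrite integral_tail integral_itv_bndo_bndc// half -EFinD => -[].
lra.
Qed.

Lemma null_marginal_ge nu a t : has_density nu (fun x => g (x - t)) ->
  nu `[a, +oo[%classic = (G (a - t))%:E.
Proof. by move=> ->//; rewrite integral_shifted_tail. Qed.

Lemma null_marginal_le nu b t : has_density nu (fun x => g (x - t)) ->
  nu `]-oo, b]%classic = (G (t - b))%:E.
Proof.
move=> ->//; rewrite -[b]opprK ge0_integration_by_substitutionNy//.
- rewrite opprK addrC -[t]opprK -integral_shifted_tail.
  by apply: eq_integral => x _ /=; rewrite -gN opprD !opprK.
- apply: continuous_subspaceT => x.
  apply: continuous_comp; last exact: g_cont.
  by apply: cvgB => //; exact: cvg_cst.
Qed.

End Tail.

(** * Sensitivity of the p-values to the center *)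

(** The quantity whose supremum enters [eta_of]: up to the factor [delta], the
    relative error on a p-value close to [t] caused by an error [delta] on the
    location. *)
Definition sensitivity {R : realType} (g : R -> R) (t : R) : R :=
  1 / (Gbar_inv g (t / 2) - Gbar_inv g t)
  * (g (Gbar_inv g t) / g (Gbar_inv g (t / 2))).

Section Sensitivity.
Context {R : realType} (g : R -> R).
Hypothesis hg : symmetric_unimodal_density g.
Local Notation G := (Gbar g).
Local Notation Ginv := (Gbar_inv g).

(** The mass [t / 2] between the quantiles of orders [t] and [t / 2] is trapped
    between the rectangles of heights [g x] and [g y]. *)
Lemma quantile_gap t : 0 < t -> t < 1 / 2 ->
  let x := Ginv (t / 2) in let y := Ginv t in
  [/\ 0 <= y, y < x, 0 < g x, g x <= g y &
      (x - y) * g x <= t / 2 <= (x - y) * g y].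
Proof.
move=> t0 t1 x y.
have Gx : G x = t / 2 by rewrite Gbar_invK//; lra.
have Gy : G y = t by rewrite Gbar_invK//; lra.
have y0 : 0 <= y by apply: Gbar_inv_ge0 => //; lra.
have yx : y < x.
  by rewrite ltNge; apply/negP => /(Gbar_anti hg); rewrite Gx Gy; lra.
have gx : 0 < g x by apply: density_gt0 => //; rewrite ?Gx; lra.
have gxy : g x <= g y by case: hg => _ _ _; apply => //; exact: ltW.
have := Gbar_drop hg y0 (ltW yx); rewrite Gx Gy.
by split=> //; lra.
Qed.

Lemma sensitivity_gap t : 0 < t -> t < 1 / 2 ->
  1 <= sensitivity g t * (Ginv (t / 2) - Ginv t).
Proof.
move=> t0 t1; have [y0 yx gx gxy _] := quantile_gap t0 t1.
have xy : 0 < Ginv (t / 2) - Ginv t by rewrite subr_gt0.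
rewrite /sensitivity div1r mulrAC mulVf ?gt_eqF// mul1r.
by rewrite ler_pdivlMr// mul1r.
Qed.

Lemma sensitivity_ge0 t : 0 < t -> t < 1 / 2 -> 0 <= sensitivity g t.
Proof.
move=> t0 t1; have [y0 yx gx gxy _] := quantile_gap t0 t1.
by rewrite mulr_ge0// divr_ge0 ?subr_ge0//; lra.
Qed.

(** Boundedness away from level [0]: the two quantiles are at distance at least
    [t / (2 * g 0)], and the density at the outer one is bounded below by its
    value at the outermost quantile. *)
Lemma sensitivity_bounded a b : 0 < a -> b < 1 / 2 ->
  has_ubound [set sensitivity g t | t in `[a, b]].
Proof.
move=> a0 b1; pose K := 2 * g 0 / a * (g 0 / g (Ginv (a / 2))).
exists K => s [t /=]; rewrite in_itv/= => /andP[at_ tb] <-.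
have t0 : 0 < t by lra.
have t1 : t < 1 / 2 by lra.
have [y0 yx gx gxy /andP[_ h]] := quantile_gap t0 t1.
have [_ ya ga _ _] := quantile_gap a0 (le_lt_trans at_ t1).
have x0 : 0 <= Ginv (t / 2) by rewrite (le_trans y0)// ltW.
have xxa : Ginv (t / 2) <= Ginv (a / 2).
  apply: Gbar_le_inv => //; rewrite ?Gbar_invK//; try lra.
  by apply: le_trans (ltW ya); apply: Gbar_inv_ge0 => //; lra.
have gxa : g (Ginv (a / 2)) <= g (Ginv (t / 2)).
  by case: hg => _ _ _; apply.
have gy0 := density_le_mode hg (Ginv t).
have g0 : 0 < g 0 by lra.
rewrite /sensitivity /K; apply: ler_pM.
- by rewrite divr_ge0// subr_ge0 ltW.
- by rewrite divr_ge0//; lra.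
- rewrite ler_pdivrMr ?subr_gt0// mulrAC ler_pdivlMr//.
  have : a / 2 <= (Ginv (t / 2) - Ginv t) * g 0.
    by rewrite (le_trans _ (le_trans h _))// ?ler_wpM2l//; lra.
  by lra.
- apply: ler_pM => //; first lra.
    by rewrite invr_ge0 ltW.
  by rewrite lef_pV2.
Qed.

(** The outer quantile can be moved inwards by [d] at the cost of a relative
    error [d * sensitivity g t] on its level: as long as the inner quantile is
    not crossed, the density picked up is at most its value there. *)
Lemma Gbar_shifted_quantile t d : 0 < t -> t < 1 / 2 -> 0 <= d ->
  d * sensitivity g t <= 1 ->
  G (Ginv (t / 2) - d) <= t / 2 * (1 + d * sensitivity g t).
Proof.
move=> t0 t1 d0 ds.
have [y0 yx gx gxy /andP[h _]] := quantile_gap t0 t1.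
have gap := sensitivity_gap t0 t1.
have s0 := sensitivity_ge0 t0 t1.
have Gx : G (Ginv (t / 2)) = t / 2 by rewrite Gbar_invK//; lra.
have xy : 0 < Ginv (t / 2) - Ginv t by rewrite subr_gt0.
have dxy : d <= Ginv (t / 2) - Ginv t.
  have : d * 1 <= d * (sensitivity g t * (Ginv (t / 2) - Ginv t)).
    by rewrite ler_wpM2l.
  by rewrite mulr1 mulrA => /le_trans; apply; rewrite ler_piMl// ltW.
have xd : Ginv (t / 2) - d <= Ginv (t / 2) by lra.
have /andP[_] := Gbar_drop hg (ltac:(lra) : 0 <= Ginv (t / 2) - d) xd.
rewrite Gx opprB addrCA subrr addr0 => drop.
have gd : g (Ginv (t / 2) - d) <= g (Ginv t).
  by case: hg => _ _ _; apply => //; lra.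
have : d * g (Ginv (t / 2) - d) <= d * g (Ginv t) by rewrite ler_wpM2l.
have -> : g (Ginv t) =
    sensitivity g t * ((Ginv (t / 2) - Ginv t) * g (Ginv (t / 2))).
  by rewrite /sensitivity; field; rewrite !gt_eqF.
have : d * (sensitivity g t * ((Ginv (t / 2) - Ginv t) * g (Ginv (t / 2)))) <=
       d * (sensitivity g t * (t / 2)) by rewrite !ler_wpM2l.
by lra.
Qed.

(** Here [a] and [b] stand for the distances of one observation to two centers at
    most [d] apart. *)
Lemma pvalue_shift t d e a b : 0 < t -> t < 1 / 2 -> 0 <= d ->
  d * sensitivity g t <= e -> e <= 1 -> 0 <= a -> a - d <= b ->
  2 * G a <= t -> 2 * G b <= t * (1 + e).
Proof.
move=> t0 t1 d0 de e1 a0 ab Ga.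
have h := Gbar_shifted_quantile t0 t1 d0 (le_trans de e1).
have xa : Ginv (t / 2) <= a by apply: Gbar_le_inv => //; lra.
have /(Gbar_anti hg) : Ginv (t / 2) - d <= b by lra.
have : t / 2 * (1 + d * sensitivity g t) <= t / 2 * (1 + e).
  by rewrite ler_wpM2l ?lerD2l//; lra.
by lra.
Qed.

(** A supremum in [R] dominates its set only when the set is bounded. *)
Lemma eta_of_sensitivity c2 n k alpha t : 0 < c2 -> (0 < n)%N ->
  0 < alpha -> alpha < 1 / 2 -> 95 / 100 * alpha / n%:R <= t <= alpha ->
  c2 * Num.max (k%:R / n%:R) (n%:R `^ (- (1 / 6))) * sensitivity g t
    <= eta_of c2 g n k alpha.
Proof.
move=> c20 n0 a0 a1 tI; rewrite /eta_of ler_wpM2l//.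
  by rewrite mulr_ge0 ?(ltW c20)// le_max divr_ge0.
apply: sup_upper_bound; last by exists t.
split; first by exists (sensitivity g t), t.
by apply: sensitivity_bounded => //; rewrite divr_gt0 ?mulr_gt0 ?ltr0n//; lra.
Qed.

(** A linear gain over [1 / 2]: up to the upper quartile [q], the density is at
    least [g q]; beyond it, the gain is already [1 / 4], which dominates. *)
Lemma Gbar_linear_gain : exists2 c, 0 < c &
  forall r, 0 <= r -> r <= 1 / 10 -> 1 / 2 + 5 / 4 * r <= G (- (c * r)).
Proof.
pose q := Ginv (1 / 4).
have Gq : G q = 1 / 4 by rewrite Gbar_invK//; lra.
have q0 : 0 <= q by apply: Gbar_inv_ge0 => //; lra.
have gq : 0 < g q by apply: density_gt0 => //; rewrite Gq; lra.
exists (2 / g q); first by rewrite divr_gt0.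
move=> r r0 r1; set d := 2 / g q * r.
have d0 : 0 <= d by rewrite mulr_ge0// divr_ge0// ltW.
rewrite GbarN//; have [dq|/ltW qd] := leP d q; last first.
  by have := Gbar_anti hg qd; rewrite Gq; lra.
have /andP[+ _] := Gbar_drop hg (lexx 0) d0.
rewrite subr0 Gbar0// => drop.
have : d * g q <= d * g d by rewrite ler_wpM2l//; case: hg => _ _ _; apply.
have -> : d * g q = 2 * r by rewrite /d; field; rewrite gt_eqF.
lra.
Qed.
End Sensitivity.

(** * The step-up rule for arbitrary p-values *)

Section StepUp.
Context {R : realType} {n : nat}.
Implicit Types (p q : 'I_n -> R) (alpha t : R).

Definition pcount p t : nat := #|[set i | p i <= t]%SET|.

(** [BH_threshold] as a function of the p-values alone: the two are convertible
    for [p := pval g u y]. *)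
Definition threshold alpha p : R :=
  sup [set t | 0 <= t <= 1 /\
               n%:R * t / alpha <= \sum_(i < n) ((p i <= t)%R : nat)%:R].

Definition rejected alpha p : {set 'I_n} := [set i | p i <= threshold alpha p]%SET.

Lemma pcountE p t : \sum_(i < n) ((p i <= t)%R : nat)%:R = (pcount p t)%:R :> R.
Proof.
rewrite -natr_sum; congr _%:R.
by rewrite /pcount -sum1dep_card [RHS]big_mkcond; apply: eq_bigr => i _; case: ifP.
Qed.

Lemma pcount_mono p s t : s <= t -> (pcount p s <= pcount p t)%N.
Proof.
move=> st; apply: subset_leq_card; apply/fintype.subsetP => i; rewrite !inE => h.
exact: le_trans st.
Qed.

Lemma card_rejected alpha p : #|rejected alpha p| = pcount p (threshold alpha p).
Proof. by []. Qed.

Let cand alpha p := [set t | 0 <= t <= 1 /\ n%:R * t / alpha <= (pcount p t)%:R].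

Let thresholdE alpha p : threshold alpha p = sup (cand alpha p).
Proof.
rewrite /threshold /cand; congr sup; apply/funext => t.
by rewrite /= pcountE.
Qed.

Let cand_sup alpha p : has_sup (cand alpha p).
Proof.
split; first by exists 0; split; rewrite ?lexx ?ler01// mulr0 mul0r.
by exists 1 => t [/andP[]].
Qed.

Lemma threshold_ge alpha p t : 0 <= t -> t <= 1 ->
  n%:R * t / alpha <= (pcount p t)%:R -> t <= threshold alpha p.
Proof.
move=> t0 t1 h; rewrite thresholdE.
by apply: sup_upper_bound => //; split=> //; rewrite t0.
Qed.

(** The supremum is attained: the count at the supremum dominates the count at
    every candidate below it. *)
Lemma threshold_attained alpha p : 0 < alpha ->
  n%:R * threshold alpha p / alpha <= (pcount p (threshold alpha p))%:R.
Proof.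
move=> a0; set T := threshold alpha p.
have [->|n0] := posnP n; first by rewrite !mul0r.
have na : 0 < n%:R / alpha :> R by rewrite divr_gt0// ltr0n.
suff : T <= (pcount p T)%:R / (n%:R / alpha).
  by rewrite ler_pdivlMr//; lra.
rewrite /T thresholdE; apply: ge_sup; first by have [] := cand_sup alpha p.
move=> t ct; rewrite -thresholdE -/T ler_pdivlMr//.
have tT : t <= T by rewrite /T thresholdE; apply: sup_upper_bound.
have [_] := ct.
have : (pcount p t)%:R <= (pcount p T)%:R :> R by rewrite ler_nat pcount_mono.
lra.
Qed.

Lemma threshold_ge0 alpha p : 0 <= threshold alpha p.
Proof. by apply: threshold_ge => //; rewrite mulr0 mul0r. Qed.

Hypothesis n0 : (0 < n)%N.

(** The threshold is the level at which the step-up line meets the counting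
    function of the p-values. *)
Lemma thresholdP alpha p : 0 < alpha -> alpha <= 1 ->
  threshold alpha p = alpha * #|rejected alpha p|%:R / n%:R.
Proof.
move=> a0 a1; rewrite card_rejected; set T := threshold alpha p.
have nR : 0 < n%:R :> R by rewrite ltr0n.
have h := threshold_attained p a0; rewrite -/T in h.
have TN : T <= alpha * (pcount p T)%:R / n%:R.
  by move: h; rewrite ler_pdivrMr// ler_pdivlMr//; lra.
apply/eqP; rewrite eq_le TN andTb; apply: threshold_ge.
- by rewrite divr_ge0// mulr_ge0// ltW.
- rewrite ler_pdivrMr// mul1r -[leRHS]mul1r ler_pM// ?(ltW a0)//.
  by rewrite ler_nat (leq_trans (max_card _))// card_ord.
- rewrite (_ : n%:R * _ / alpha = (pcount p T)%:R); last by field; rewrite !gt_eqF.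
  by rewrite ler_nat pcount_mono.
Qed.

Lemma rejected_le alpha p i : 0 < alpha -> alpha <= 1 -> i \in rejected alpha p ->
  p i <= alpha * #|rejected alpha p|%:R / n%:R.
Proof. by move=> a0 a1; rewrite inE {1}thresholdP. Qed.

(** The form of the step-up rule that only involves finitely many comparisons. *)
Lemma rejectedP alpha p i : 0 < alpha -> alpha <= 1 ->
  reflect (exists k : 'I_n.+1,
    (k <= pcount p (alpha * k%:R / n%:R))%N && (p i <= alpha * k%:R / n%:R))
  (i \in rejected alpha p).
Proof.
move=> a0 a1; have nR : 0 < n%:R :> R by rewrite ltr0n.
apply: (iffP idP) => [iR|[k /andP[kN pk]]].
  have rn : (#|rejected alpha p| < n.+1)%N.
    by rewrite ltnS (leq_trans (max_card _))// card_ord.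
  exists (Ordinal rn) => /=.
  by rewrite rejected_le// -thresholdP// card_rejected leqnn.
have kn : (k <= n)%N by rewrite -ltnS.
rewrite inE (le_trans pk)//; apply: threshold_ge.
- by rewrite divr_ge0// mulr_ge0// ltW.
- rewrite ler_pdivrMr// mul1r -[leRHS]mul1r ler_pM// ?(ltW a0)//.
  by rewrite ler_nat.
- rewrite (_ : n%:R * _ / alpha = k%:R); last by field; rewrite !gt_eqF.
  by rewrite ler_nat.
Qed.

(** A rejected p-value moved anywhere below [alpha / n], which is the smallest
    nonzero threshold, leaves the counting function unchanged above the threshold,
    and hence leaves the threshold in place. *)
Lemma rejected_perturb alpha p q i : 0 < alpha -> alpha <= 1 ->
  i \in rejected alpha p -> q i <= alpha / n%:R ->
  (forall j, j != i -> q j = p j) -> rejected alpha q = rejected alpha p.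
Proof.
move=> a0 a1 iR qi qp; have nR : 0 < n%:R :> R by rewrite ltr0n.
have r1 : (0 < #|rejected alpha p|)%N by apply/card_gt0P; exists i.
have aT : alpha / n%:R <= threshold alpha p.
  rewrite thresholdP// ler_wpM2r ?invr_ge0 ?(ltW nR)//.
  by rewrite ler_peMr ?(ltW a0)// ler1n.
have same t : threshold alpha p <= t -> forall j, (q j <= t) = (p j <= t).
  move=> Tt j; have [->|/qp->//] := eqVneq j i.
  rewrite (le_trans qi (le_trans aT Tt)); symmetry.
  by move: iR; rewrite inE => /le_trans; apply.
have cnt t : threshold alpha p <= t -> pcount q t = pcount p t.
  by move=> Tt; apply: eq_card => j; rewrite !inE same.
have TT : threshold alpha q = threshold alpha p.
  have le1 : threshold alpha p <= threshold alpha q.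
    apply: threshold_ge; [exact: threshold_ge0| |].
    - rewrite thresholdP// ler_pdivrMr// mul1r -[leRHS]mul1r ler_pM// ?(ltW a0)//.
      by rewrite ler_nat (leq_trans (max_card _))// card_ord.
    - by rewrite cnt//; exact: threshold_attained.
  apply/eqP; rewrite eq_le le1 andbT; apply: threshold_ge.
  - exact: threshold_ge0.
  - rewrite thresholdP// ler_pdivrMr// mul1r -[leRHS]mul1r ler_pM// ?(ltW a0)//.
    by rewrite ler_nat (leq_trans (max_card _))// card_ord.
  - by rewrite -cnt//; exact: threshold_attained.
by apply/setP => j; rewrite !inE TT same.
Qed.

(** A relative error [e] on the p-values is absorbed by a relative change of the
    level: the step-up line is steeper at the smaller level. *)
Lemma rejected_subset alpha beta e p q : 0 < alpha -> alpha <= 1 ->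
  0 < beta -> 0 <= e -> beta * (1 + e) <= alpha ->
  (forall i t, beta / n%:R <= t <= beta -> p i <= t -> q i <= t * (1 + e)) ->
  rejected beta p \subset rejected alpha q.
Proof.
move=> a0 a1 b0 e0 ba pq; have nR : 0 < n%:R :> R by rewrite ltr0n.
have bla : beta <= alpha.
  have : beta * 1 <= beta * (1 + e) by rewrite ler_wpM2l ?(ltW b0)//; lra.
  by lra.
have TB := thresholdP p b0 (ltac:(lra) : beta <= 1).
apply/fintype.subsetP => i iR.
have r1 : (0 < #|rejected beta p|)%N by apply/card_gt0P; exists i.
have rn : (#|rejected beta p| <= n)%N by rewrite (leq_trans (max_card _))// card_ord.
set T := threshold beta p in TB.
have Tb : beta / n%:R <= T <= beta.
  rewrite TB ler_wpM2r ?invr_ge0 ?(ltW nR)//=.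
    by rewrite ler_pdivrMr// ler_wpM2l ?(ltW b0)// ler_nat.
  by rewrite ler_peMr ?(ltW b0)// ler1n.
have Tq j : j \in rejected beta p -> q j <= T * (1 + e).
  by rewrite inE => /(pq _ _ Tb).
rewrite inE (le_trans (Tq _ iR))//; move/andP: Tb => [T1 T2].
have T0 : 0 <= T by rewrite (le_trans _ T1)// divr_ge0// ltW.
have Te : T * (1 + e) <= beta * (1 + e) by rewrite ler_wpM2r//; lra.
apply: threshold_ge; [by rewrite mulr_ge0//; lra | lra |].
apply: (@le_trans _ _ #|rejected beta p|%:R); last first.
  rewrite ler_nat; apply/subset_leq_card/fintype.subsetP => j /Tq; by rewrite inE.
have -> : #|rejected beta p|%:R = n%:R * T / beta :> R.
  by rewrite TB; field; rewrite !gt_eqF.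
rewrite ler_pdivrMr// mulrAC ler_pdivlMr// -!mulrA ler_wpM2l ?(ltW nR)//.
have : T * ((1 + e) * beta) <= T * alpha by rewrite ler_wpM2l//; lra.
lra.
Qed.

End StepUp.

(** * Order statistics *)

Section OrderStatistics.
Context {R : realType} {n : nat}.
Implicit Types (y z : n.-tuple R) (x : R) (j : nat).

Lemma card_tnth y (a : pred R) : #|[set i | a (tnth y i)]%SET| = count a y.
Proof. by rewrite -sum1_count big_tuple sum1dep_card. Qed.

Lemma order_stat_le j y x : (0 < j <= n)%N ->
  (order_stat j y <= x) = (j <= #|[set i | (tnth y i <= x)%R]%SET|)%N.
Proof.
move=> /andP[j0 jn]; rewrite (card_tnth y (fun w => w <= x)).
have ss : sorted <=%R (sort <=%R y) by apply: sort_sorted; exact: le_total.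
have cs : count (fun w => w <= x) (sort <=%R y) = count (fun w => w <= x) y.
  by apply/permP; rewrite perm_sort.
rewrite /order_stat -cs; case: (leqP j) => h.
- by apply: Order.PreorderTheory.nth_count_le => //; rewrite prednK.
- apply/negbTE; rewrite -ltNge; apply: Order.TotalTheory.DualTotalTheory.nth_count_gt => //.
  by rewrite size_sort size_tuple -ltnS !prednK// h.
Qed.

Lemma order_stat_lt j y x : (0 < j <= n)%N ->
  (order_stat j y < x) = (j <= #|[set i | (tnth y i < x)%R]%SET|)%N.
Proof.
move=> /andP[j0 jn]; rewrite (card_tnth y (fun w => w < x)).
have ss : sorted <=%R (sort <=%R y) by apply: sort_sorted; exact: le_total.
have cs : count (fun w => w < x) (sort <=%R y) = count (fun w => w < x) y.
  by apply/permP; rewrite perm_sort.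
rewrite /order_stat -cs; case: (leqP j) => h.
- by apply: Order.PreorderTheory.nth_count_lt => //; rewrite prednK.
- apply/negbTE; rewrite -leNgt; apply: Order.TotalTheory.DualTotalTheory.nth_count_ge => //.
  by rewrite size_sort size_tuple -ltnS !prednK// h.
Qed.

(** An order statistic only sees on which side of it the entries lie. *)
Lemma order_stat_eq j y z : (0 < j <= n)%N ->
  (forall i, (tnth z i <= order_stat j y) = (tnth y i <= order_stat j y)) ->
  (forall i, (tnth z i < order_stat j y) = (tnth y i < order_stat j y)) ->
  order_stat j z = order_stat j y.
Proof.
move=> jn le_eq lt_eq; apply/eqP; rewrite eq_le; apply/andP; split.
  rewrite order_stat_le// (eq_card (B := [set i | tnth y i <= order_stat j y]%SET)).
    by rewrite -order_stat_le.
  by move=> i; rewrite !inE le_eq.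
rewrite leNgt order_stat_lt// (eq_card (B := [set i | tnth y i < order_stat j y]%SET)).
  by rewrite -order_stat_lt// ltxx.
by move=> i; rewrite !inE lt_eq.
Qed.

Definition subst_coord (i : 'I_n) (c : R) y : n.-tuple R :=
  [tuple if k == i then c else tnth y k | k < n].

Lemma tnth_subst i c y k :
  tnth (subst_coord i c y) k = if k == i then c else tnth y k.
Proof. by rewrite tnth_mktuple. Qed.

Lemma order_stat_subst_gt j i c y : (0 < j <= n)%N ->
  order_stat j y < tnth y i -> order_stat j y < c ->
  order_stat j (subst_coord i c y) = order_stat j y.
Proof.
move=> jn yi yc; apply: order_stat_eq => // k; rewrite tnth_subst; case: eqP => // ->.
  by rewrite !leNgt yi yc.
by rewrite !ltNge (ltW yi) (ltW yc).
Qed.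

Lemma order_stat_subst_lt j i c y : (0 < j <= n)%N ->
  tnth y i < order_stat j y -> c < order_stat j y ->
  order_stat j (subst_coord i c y) = order_stat j y.
Proof.
move=> jn yi yc; apply: order_stat_eq => // k; rewrite tnth_subst; case: eqP => // ->.
  by rewrite (ltW yi) (ltW yc).
by rewrite yi yc.
Qed.

End OrderStatistics.

Section Measurability.
Context {R : realType}.

(** The level sets of [phi] are finite intersections of its membership events and
    their complements. *)
Lemma measurable_set_valued d (T : measurableType d) n (phi : T -> {set 'I_n})
  (Q : set {set 'I_n}) :
  (forall i, measurable [set y | i \in phi y]) ->
  measurable [set y | Q (phi y)].
Proof.
move=> mphi.
have mS (S : {set 'I_n}) : measurable [set y | phi y = S].
  have -> : [set y | phi y = S] =
      \bigcap_(i in [set: 'I_n]) [set y | (i \in phi y) = (i \in S)].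
    apply/seteqP; split=> y /=; first by move=> eS i _ /=; rewrite eS.
    by move=> h; apply/setP => i; exact: h.
  apply: fin_bigcap_measurable => // i _.
  case: (i \in S); first exact: mphi.
  rewrite (_ : [set _ | _] = ~` [set y | i \in phi y]); first exact/measurableC.
  by apply/seteqP; split=> y /=; [move=> ->|move/negP/negbTE].
have -> : [set y | Q (phi y)] =
    \bigcup_(S in [set S | Q S]) [set y | phi y = S].
  by apply/seteqP; split=> y /=; [exists (phi y)|move=> [S /= QS eS]; rewrite eS].
by apply: fin_bigcup_measurable.
Qed.
End Measurability.

(** * Measurability of the procedures, and independence of the coordinates *)

Section MeasurableProcedures.
Context {R : realType} {n : nat}.
Implicit Types (g : R -> R) (u : n.-tuple R -> R).

Lemma measurable_ray_preimage d (T : measurableType d) (f : T -> R) t :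
  measurable_fun setT f -> measurable [set y | f y <= t].
Proof.
move=> mf; rewrite (_ : [set y | _] = f @^-1` `]-oo, t]%classic).
  by rewrite -[X in measurable X]setTI; exact: mf.
by apply/seteqP; split=> y /=; rewrite in_itv.
Qed.

Lemma measurable_order_stat j : (0 < j <= n)%N ->
  measurable_fun setT (@order_stat R n j).
Proof.
move=> jn; apply: (measurability (@RGenOInfty.G R)); first exact: RGenOInfty.measurableE.
move=> _ [_ [x ->] <-]; rewrite setTI.
rewrite (_ : _ @^-1` _ = ~` [set y | (j <= #|[set i | (tnth y i <= x)%R]%SET|)%N]).
  apply: measurableC; apply: (measurable_set_valued
    (phi := fun y : n.-tuple R => [set i | tnth y i <= x]%SET) (fun S => (j <= #|S|)%N)) => i.
  rewrite (_ : [set y | _] = [set y : n.-tuple R | tnth y i <= x]).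
    by apply: measurable_ray_preimage; exact: measurable_tnth.
  by apply/seteqP; split=> y /=; rewrite inE.
apply/seteqP; split=> y /=; rewrite in_itv/= andbT -order_stat_le//.
  by rewrite ltNge => /negP.
by rewrite ltNge => /negP.
Qed.

Lemma measurable_pval g u i : symmetric_unimodal_density g ->
  measurable_fun setT u -> measurable_fun setT (fun y => pval g (u y) y i).
Proof.
move=> hg mu; apply: measurable_funM => //.
apply: (measurableT_comp (measurable_Gbar hg)).
apply: measurableT_comp => //.
by apply: measurable_funB => //; exact: measurable_tnth.
Qed.

Lemma measurable_BH g alpha u (Q : set {set 'I_n}) :
  symmetric_unimodal_density g -> (0 < n)%N -> 0 < alpha -> alpha <= 1 ->
  measurable_fun setT u -> measurable [set y | Q (BH g alpha u y)].
Proof.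
move=> hg n0 a0 a1 mu; apply: measurable_set_valued => i.
rewrite (_ : [set y | _] = \bigcup_(k in [set: 'I_n.+1])
    ([set y | (k <= pcount (pval g (u y) y) (alpha * k%:R / n%:R))%N] `&`
     [set y | pval g (u y) y i <= alpha * k%:R / n%:R])).
  apply: fin_bigcup_measurable => // k _; apply: measurableI.
    apply: (measurable_set_valued
      (phi := fun y => [set i | pval g (u y) y i <= alpha * k%:R / n%:R]%SET)
      (fun S => (k <= #|S|)%N)) => l.
    rewrite (_ : [set y | _] = [set y | pval g (u y) y l <= alpha * k%:R / n%:R]).
      by apply: measurable_ray_preimage; exact: measurable_pval.
    by apply/seteqP; split=> y /=; rewrite inE.
  by apply: measurable_ray_preimage; exact: measurable_pval.
apply/seteqP; split=> y /=.
  by move=> /(rejectedP n0 _ _ a0 a1)[k /andP[]]; exists k.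
by move=> [k _ [/= h1 h2]]; apply/(rejectedP n0 _ _ a0 a1); exists k; apply/andP.
Qed.

Lemma measurable_subst (i : 'I_n) c : measurable_fun setT (@subst_coord R n i c).
Proof.
apply/measurable_fun_tnthP => k.
rewrite (_ : _ \o _ = if k == i then cst c else fun y => tnth y k).
  by case: eqP => // _; exact: measurable_tnth.
by apply/funext => y /=; rewrite tnth_subst; case: eqP.
Qed.

End MeasurableProcedures.

Section Independence.
Context {R : realType} {n : nat} (P : probability (n.-tuple R) R).
Hypothesis indepP : is_product P.

Definition rectangle (A : 'I_n -> set R) : set (n.-tuple R) :=
  [set y | forall i, A i (tnth y i)].

Lemma measurable_rectangle A : (forall i, measurable (A i)) -> measurable (rectangle A).
Proof.
move=> mA; rewrite (_ : rectangle A =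
    \bigcap_(i in [set: 'I_n]) ((tnth (T := R))^~ i @^-1` A i)).
  apply: fin_bigcap_measurable => // i _.
  rewrite -[X in measurable X]setTI; exact: measurable_tnth.
by apply/seteqP; split=> y; [move=> h i _; exact: h|move=> h i; exact: h].
Qed.

Lemma tuple_measurable_rectangles :
  @measurable _ (n.-tuple R) =
  <<s [set rectangle A | A in [set A | forall i, measurable (A i)]] >>.
Proof.
apply/seteqP; split=> B.
  apply: smallest_sub => {B}; first exact: smallest_sigma_algebra.
  move=> B; rewrite -bigcup_seq => -[i /= _ [A mA <-]]; apply: sub_sigma_algebra.
  exists (fun k => if k == i then A else setT); first by move=> k; case: eqP.
  apply/seteqP; split=> y /=; first by move=> /(_ i); rewrite eqxx.
  by move=> [_ Ai] k; case: eqP => // ->.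
apply: smallest_sub; first exact: sigma_algebra_measurable.
by move=> _ [A mA <-]; exact: measurable_rectangle.
Qed.

Lemma prob_rectangle A : (forall i, measurable (A i)) ->
  P (rectangle A) = (\prod_(i < n) marginal P i (A i))%E.
Proof. exact: indepP. Qed.

Lemma marginal_setT i : marginal P i setT = 1%E.
Proof. by rewrite /marginal /pushforward preimage_setT probability_setT. Qed.

Lemma measurable_coord (i : 'I_n) (A : set R) : measurable A ->
  measurable [set y : n.-tuple R | A (tnth y i)].
Proof.
move=> mA; rewrite -[X in measurable X]setTI.
exact: (@measurable_tnth _ R n i measurableT A mA).
Qed.

(** Freezing coordinate [i] at [c] produces an event about the other coordinates
    only.  Both sides are finite measures of [C], and they agree on rectangles. *)
Lemma indep_subst (i : 'I_n) c (A : set R) (C : set (n.-tuple R)) :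
  measurable A -> measurable C ->
  P ([set y | C (subst_coord i c y)] `&` [set y | A (tnth y i)]) =
  (P [set y | C (subst_coord i c y)] * marginal P i A)%E.
Proof.
move=> mA mC; set s := subst_coord i c.
have ms : measurable_fun setT s := measurable_subst i c.
pose EA := [set y : n.-tuple R | A (tnth y i)].
have mE : measurable EA := measurable_coord i mA.
have q0 : 0 <= fine (P EA) by apply/fine_ge0/measure_ge0.
have PE : (fine (P EA))%:E = P EA by rewrite fineK// fin_num_measure.
pose G := [set rectangle B | B in [set B | forall i, measurable (B i)]].
pose pushforward_measure (m : {measure set (n.-tuple R) -> \bar R}) :=
  measure_function_pushforward__canonical__measure_function_Measure m ms.
pose m1 := pushforward_measure (mrestr P mE).
pose m2 := mscale (NngNum q0) (pushforward_measure P).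
suff : m1 C = m2 C by rewrite /m1 /m2 /= /mscale /pushforward /mrestr/= PE muleC.
apply: (measure_unique G (fun=> setT)) => //.
- exact: tuple_measurable_rectangles.
- move=> _ _ [B mB <-] [B' mB' <-]; exists (fun k => B k `&` B' k).
    by move=> k; apply: measurableI; [exact: mB|exact: mB'].
  apply/seteqP; split=> y /=; first by move=> h; split=> k; have [] := h k.
  by move=> [h h'] k; split; [exact: h|exact: h'].
- by move=> _; exists (fun=> setT) => //; apply/seteqP; split.
- by rewrite bigcup_const//; exists 0%N.
- move=> _ [B mB <-].
  change (P ([set y | rectangle B (s y)] `&` EA) =
    ((fine (P EA))%:E * P [set y | rectangle B (s y)])%E).
  rewrite PE.
  (* Freezing coordinate [i] either kills the rectangle or frees its side [i]. *)
  have rectE D : [set y | rectangle B (s y)] `&` [set y | D (tnth y i)] =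
      (if `[< B i c >] then rectangle (fun k => if k == i then D else B k) else set0).
    case: asboolP => Bc; apply/seteqP; split=> y //=.
    + move=> [h Dy] k; case: eqVneq => [->//|ki].
      by have := h k; rewrite tnth_subst (negbTE ki).
    + move=> h; split; last by have := h i; rewrite eqxx.
      by move=> k; rewrite tnth_subst; have := h k; case: eqVneq => [->|].
    + by move=> [/(_ i)]; rewrite tnth_subst eqxx.
  have -> : [set y | rectangle B (s y)] =
      [set y | rectangle B (s y)] `&` [set y | setT (tnth y i)].
    by rewrite setIT.
  rewrite -setIA (_ : [set y | setT (tnth y i)] `&` EA = EA); last by rewrite setTI.
  rewrite !rectE; case: asboolP => Bc; last by rewrite measure0 mule0.
  have mD D : measurable D -> forall k, measurable (if k == i then D else B k).
    by move=> mD k; case: eqP.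
  rewrite !prob_rectangle; [|exact: mD|exact: mD].
  rewrite [LHS](bigD1 i)//= [in RHS](bigD1 i)//= !eqxx marginal_setT mul1e; congr (_ * _)%E.
  by apply: eq_bigr => k /negbTE ->.
- move=> _; rewrite /m1 /= /pushforward /mrestr.
  apply: (le_lt_trans (probability_le1 _ _)); rewrite ?ltry//.
  by apply: measurableI => //; rewrite preimage_setT.
Qed.
End Independence.

(** * Chernoff bound for independent coordinates *)

Section ProbabilityBounds.
Local Open Scope ereal_scope.
Context {R : realType} d (T : measurableType d) (P : probability T R).

(** The set [B] carries the exceptional part of [f], the events [E j] the rest. *)
Lemma expectation_le_simple (J : finType) (c : J -> R) (E : J -> set T)
    (B : set T) (f : T -> R) :
  measurable_fun setT f -> (forall y, 0 <= f y)%R -> (forall j, 0 <= c j)%R ->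
  measurable B -> (forall j, measurable (E j)) ->
  (forall y, f y <= \1_B y + \sum_j c j * \1_(E j) y)%R ->
  'E_P[f] <= P B + \sum_j (c j)%:E * P (E j).
Proof.
move=> mf f0 c0 mB mE fE; rewrite unlock.
have m1 A : measurable A -> measurable_fun setT (fun y : T => (\1_A y : R)%:E).
  by move=> mA; apply/measurable_EFinP; exact: measurable_indic.
have mt j : measurable_fun setT (fun y => (c j)%:E * (\1_(E j) y)%:E).
  by apply: emeasurable_funM => //; exact: m1.
have t0 j y : setT y -> 0 <= (c j)%:E * (\1_(E j) y)%:E.
  by move=> _; rewrite -EFinM lee_fin mulr_ge0.
apply: (@le_trans _ _ (\int[P]_y ((\1_B y)%:E + \sum_j (c j)%:E * (\1_(E j) y)%:E))).
  apply: ge0_le_integral => //=.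
  - by move=> y _; rewrite lee_fin.
  - exact/measurable_EFinP.
  - by apply: emeasurable_funD; [exact: m1|exact: emeasurable_sum].
  - move=> y _; under eq_bigr do rewrite -EFinM.
    by rewrite sumEFin -EFinD lee_fin.
rewrite ge0_integralD//; first last.
- exact: emeasurable_sum.
- by move=> y _; apply: sume_ge0 => j _; exact: t0.
- exact: m1.
rewrite integral_indic// setIT ge0_integral_sum//; apply: leeD2l; apply: lee_sum => j _.
by rewrite ge0_integralZl_EFin ?integral_indic ?setIT//; exact: m1.
Qed.

Lemma prob_le_sum (J : finType) (Q : pred J) (E : J -> set T) (A : set T) :
  measurable A -> (forall j, measurable (E j)) ->
  (forall y, A y -> exists2 j, Q j & E j y) ->
  P A <= \sum_(j | Q j) P (E j).
Proof.
move=> mA mE AE; rewrite -expectation_indic// [leRHS]big_mkcond.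
apply: (le_trans (@expectation_le_simple J (fun j => (Q j)%:R) E set0 _ _ _ _ _ mE _)).
- exact: measurable_indic.
- by [].
- by [].
- exact: measurable0.
- move=> y; rewrite indic0 add0r indicE; case: (boolP (y \in A)) => [|_]; last first.
    by apply: sumr_ge0 => j _; rewrite mulr_ge0.
  rewrite inE => /AE[j Qj Ej]; rewrite (bigD1 j)//= Qj mul1r indicE mem_set// lerDl.
  by apply: sumr_ge0 => k _; rewrite mulr_ge0.
- by rewrite measure0 add0e; apply: lee_sum => j _; case: (Q j); rewrite ?mul1e ?mul0e.
Qed.

End ProbabilityBounds.

Section Chernoff.
Context {R : realType} {n : nat} (P : probability (n.-tuple R) R).
Hypothesis indepP : is_product P.

Definition hits (A : set R) (y : n.-tuple R) : {set 'I_n} :=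
  [set i | `[< A (tnth y i) >]]%SET.

Lemma measurable_hits A (Q : set {set 'I_n}) : measurable A ->
  measurable [set y | Q (hits A y)].
Proof.
move=> mA; apply: measurable_set_valued => i.
rewrite (_ : [set y | _] = [set y : n.-tuple R | A (tnth y i)]).
  exact: measurable_coord.
by apply/seteqP; split=> y /=; rewrite inE => /asboolP.
Qed.

Let p A i := fine (marginal P i A).

Lemma marginal_fine A i : measurable A -> marginal P i A = (p A i)%:E.
Proof.
move=> mA; rewrite /p fineK//; apply: fin_num_measure.
exact: measurable_coord.
Qed.

Lemma marginal_ge0 A i : measurable A -> 0 <= p A i.
Proof.
move=> mA; apply: fine_ge0.
exact: (measure_ge0 P).
Qed.

Lemma marginal_le1 A i : measurable A -> p A i <= 1.
Proof.
move=> mA; rewrite -lee_fin -marginal_fine//.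
by apply: (@probability_le1 _ _ _ P); exact: measurable_coord.
Qed.

Lemma marginal_setC A i : measurable A -> marginal P i (~` A) = (1 - p A i)%:E.
Proof.
move=> mA; rewrite EFinB -marginal_fine// /marginal /pushforward preimage_setC.
by rewrite probability_setC//; exact: measurable_coord.
Qed.

Lemma prob_hits A S : measurable A ->
  P [set y | hits A y = S] = (\prod_i (if i \in S then p A i else 1 - p A i))%:E.
Proof.
move=> mA; rewrite (_ : [set y | _] = rectangle (fun i => if i \in S then A else ~` A)).
  rewrite prob_rectangle//; last by move=> i; case: ifP => // _; exact: measurableC.
  rewrite -prodEFin; apply: eq_bigr => i _; case: ifP => _; first exact: marginal_fine.
  exact: marginal_setC.
apply/seteqP; split=> y /=.
  by move=> <- i; rewrite inE; case: asboolP.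
move=> h; apply/setP => i; rewrite inE; have := h i.
by case: ifP => _ ?; apply/asboolP.
Qed.

(** Since [exp (- l) <= 1 / (1 + l)] and [(1 - l + l^2) * (1 + l) = 1 + l^3]. *)
Lemma expRN_le l : 0 <= l -> l <= 1 -> expR (- l) <= 1 - l + l ^+ 2 :> R.
Proof.
move=> l0 l1.
have h1 : expR (- l) * (1 + l) <= 1.
  by rewrite -[leRHS](@expRxMexpNx_1 R l) mulrC ler_wpM2r ?expR_ge0// expR_ge1Dx.
have h2 : 1 <= (1 - l + l ^+ 2) * (1 + l).
  rewrite (_ : _ * _ = 1 + l ^+ 3); last by ring.
  by rewrite lerDl exprn_ge0.
by have := le_trans h1 h2; rewrite ler_pM2r//; lra.
Qed.

(** The left side is the Laplace transform of a Bernoulli variable of parameter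
    [r]; replacing [exp (- l)] by [1 - l + l^2] costs only the term [l^2]. *)
Lemma bernoulli_laplace (r q l : R) : q <= r -> r <= 1 -> 0 <= r -> 0 <= l -> l <= 1 ->
  r * expR (- l) + (1 - r) <= expR (- (q * l - l ^+ 2)).
Proof.
move=> qr r1 r0 l0 l1; apply: le_trans (expR_ge1Dx _).
have h1 : r * expR (- l) <= r * (1 - l + l ^+ 2) by rewrite ler_wpM2l// expRN_le.
have h2 : q * l <= r * l by rewrite ler_wpM2r.
have h3 : r * l ^+ 2 <= 1 * l ^+ 2 by rewrite ler_wpM2r// exprn_ge0.
by lra.
Qed.

(** Chernoff bound: the event is cut along the finitely many values of [hits],
    each of which has a product probability; the exponential moment of the
    number of hits then factorizes. *)
Lemma chernoff_hits (H : {set 'I_n}) A (q s l : R) : measurable A ->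
  0 <= l -> l <= 1 -> (forall i, i \in H -> (q%:E <= marginal P i A)%E) ->
  (P [set y | (#|(H :&: hits A y)%SET|%:R <= s)%R] <=
   (expR (l * s - #|H|%:R * (q * l - l ^+ 2)))%:E)%E.
Proof.
move=> mA l0 l1 qA.
have w0 S : 0 <= \prod_i (if i \in S then p A i else 1 - p A i).
  by apply: prodr_ge0 => i _; case: ifP; rewrite ?subr_ge0 ?marginal_le1 ?marginal_ge0.
pose small := [pred S : {set 'I_n} | #|(H :&: S)%SET|%:R <= s].
apply: (le_trans (@prob_le_sum _ _ _ P _ small
  (fun S => [set y | hits A y = S]) _ _ _ _)).
- by apply: (measurable_hits (fun S => #|(H :&: S)%SET|%:R <= s)).
- by move=> S; exact: (measurable_hits (fun S' => S' = S)).
- by move=> y /= h; exists (hits A y).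
under eq_bigr do rewrite prob_hits//.
rewrite sumEFin lee_fin expRD.
apply: (@le_trans _ _ (expR (l * s) * \sum_(S : {set 'I_n}) \prod_i
    (if i \in S then p A i * (if i \in H then expR (- l) else 1) else 1 - p A i))).
  rewrite big_mkcond mulr_sumr; apply: ler_sum => S _ /=.
  have -> : \prod_i (if i \in S then p A i * (if i \in H then expR (- l) else 1)
                     else 1 - p A i) =
      \prod_i (if i \in S then p A i else 1 - p A i)
      * expR (- l) ^+ #|(H :&: S)%SET|.
    rewrite -prodr_const [X in _ * X]big_mkcond -big_split/=; apply: eq_bigr => i _.
    by rewrite inE; case: (i \in S); rewrite ?andbT ?andbF ?mulr1.
  (* On the event, the exponential weight [exp (l * (s - #|H :&: S|))] is at
     least [1]. *)
  rewrite -expRM_natl mulrCA -expRD; case: ifP => hS.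
    rewrite ler_peMr//; apply: le_trans (expR_ge1Dx _).
    have : l * #|(H :&: S)%SET|%:R <= l * s by rewrite ler_wpM2l.
    lra.
  by rewrite mulr_ge0 ?expR_ge0.
rewrite -bigA_distr ler_wpM2l ?expR_ge0//.
have -> : expR (- (#|H|%:R * (q * l - l ^+ 2))) =
    \prod_(i < n) (if i \in H then expR (- (q * l - l ^+ 2)) else 1).
  by rewrite -big_mkcond prodr_const -expRM_natl mulrN.
apply: ler_prod => i _ /=.
have pi0 := marginal_ge0 i mA; have pi1 := marginal_le1 i mA.
case: ifP => iH; last by rewrite mulr1 addrC subrK ler01 lexx.
have e0 := expR_ge0 (- l); apply/andP; split.
  by rewrite addr_ge0 ?mulr_ge0 ?subr_ge0.
apply: bernoulli_laplace => //.
by rewrite -lee_fin -marginal_fine// qA.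
Qed.

End Chernoff.

(** * Concentration of the median *)

Section Median.
Context {R : realType} {n : nat}.
Hypothesis n0 : (0 < n)%N.

Lemma uphalf_index : (0 < uphalf n <= n)%N.
Proof. by rewrite uphalf_gt0 n0 leq_uphalf_double -addnn leq_addl. Qed.

Lemma measurable_median : measurable_fun setT (@sample_median R n).
Proof. exact: measurable_order_stat uphalf_index. Qed.

Lemma measurable_median_far (t d : R) :
  measurable [set y : n.-tuple R | d < `|sample_median y - t|].
Proof.
rewrite (_ : [set y | _] = ~` [set y | `|sample_median y - t| <= d]).
  apply: measurableC; apply: measurable_ray_preimage.
  apply: measurableT_comp => //.
  by apply: measurable_funB => //; exact: measurable_median.
by apply/seteqP; split=> y /=; rewrite ltNge => /negP.
Qed.

End Median.

Section Concentration.
Context {R : realType} (g : R -> R).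
Hypothesis hg : symmetric_unimodal_density g.

Lemma root6_le (n : nat) : 2 ^+ 30 <= n%:R :> R -> n%:R `^ (- (1 / 6)) <= 1 / 32 :> R.
Proof.
move=> n30; rewrite powRN [1 / 32]div1r lef_pV2 ?posrE ?powR_gt0//; last first.
  by rewrite (lt_le_trans _ n30)// exprn_gt0.
rewrite -(@ler_pXn2r _ 6)// ?nnegrE ?powR_ge0// -[leRHS]powR_mulrn ?powR_ge0// -powRrM.
rewrite mul1r mulVf// powRr1//; apply: le_trans n30.
by rewrite (_ : 32 = 2 ^+ 5)//; [rewrite -exprM | ring].
Qed.

(** With [r >= n^(-1/6)], the exponent [n r^2] is at least [n^(2/3)], which
    for [n^(1/6) >= 32] exceeds [n^(1/2)] by the factor [32]: enough for the
    division by [16] and for the leading factor [2]. *)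
Lemma two_expR_le (n : nat) (r : R) : 2 ^+ 30 <= n%:R :> R ->
  n%:R `^ (- (1 / 6)) <= r ->
  2 * expR (- (n%:R * r ^+ 2 / 16)) <= expR (- (n%:R `^ (1 / 2))).
Proof.
move=> n30; pose w : R := n%:R `^ (1 / 6).
have pw k : w ^+ k = n%:R `^ (k%:R / 6).
  by rewrite -powR_mulrn ?powR_ge0// /w -powRrM; congr (_ `^ _); lra.
have n6 : n%:R = w ^+ 6 by rewrite pw divff// powRr1.
have -> : n%:R `^ (1 / 2) = w ^+ 3 by rewrite pw; congr (_ `^ _); lra.
have w0 : 0 <= w by exact: powR_ge0.
have w32 : 32 <= w.
  have := root6_le n30; rewrite powRN -/w div1r lef_pV2//; rewrite posrE//.
  by rewrite powR_gt0// (lt_le_trans _ n30)// exprn_gt0.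
rewrite powRN -/w => wr.
have r0 : 0 <= r by apply: le_trans wr; rewrite invr_ge0.
have nr : w ^+ 4 <= n%:R * r ^+ 2.
  have -> : w ^+ 4 = n%:R * (w^-1) ^+ 2 by rewrite n6; field; rewrite gt_eqF//; lra.
  by rewrite ler_wpM2l// ler_pXn2r// nnegrE// invr_ge0.
have w3 : 1 <= w ^+ 3 by rewrite exprn_ege1//; lra.
have w4 : 32 * w ^+ 3 <= w ^+ 4.
  by rewrite [leRHS]exprS ler_wpM2r// exprn_ge0.
have e1 : 2 <= expR 1 :> R by rewrite (le_trans _ (expR_ge1Dx _)).
apply: (@le_trans _ _ (expR 1 * expR (- (n%:R * r ^+ 2 / 16)))).
  by rewrite ler_wpM2r ?expR_ge0.
by rewrite -expRD ler_expR; lra.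
Qed.

Context {n : nat} (P : probability (n.-tuple R) R).
Hypothesis indepP : is_product P.
Variables (t r d : R) (k : nat).
Hypothesis n30 : 2 ^+ 30 <= n%:R :> R.
Hypothesis nulls : (#|~: nulls_at g P t| <= k)%N.
Hypotheses (kn : k%:R <= 1 / 10 * n%:R :> R) (kr : k%:R / n%:R <= r).
Hypotheses (nr : n%:R `^ (- (1 / 6)) <= r) (r1 : r <= 1 / 10).
Hypothesis gain : 1 / 2 + 5 / 4 * r <= Gbar g (- d).

Local Notation H := (nulls_at g P t).

Let n0 : (0 < n)%N.
Proof. by rewrite -(ltr0n R) (lt_le_trans _ n30). Qed.

Lemma null_has_density i : i \in H -> has_density (marginal P i) (fun x => g (x - t)).
Proof. by rewrite inE => /asboolP. Qed.

(** The expected number of nulls in the half-line exceeds [n / 2] by at least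
    [n r / 2]: the gain [5 / 4 * r] per null outweighs the loss of [k] nulls.
    The tilting parameter [r / 4] then gives the exponent. *)
Lemma few_nulls_in_halfline (A : set R) : measurable A ->
  (forall i, i \in H -> marginal P i A = (Gbar g (- d))%:E) ->
  (P [set y | (#|(H :&: hits A y)%SET|%:R <= n%:R / 2 :> R)%R] <=
   (expR (- (n%:R * r ^+ 2 / 16)))%:E)%E.
Proof.
move=> mA HA.
have nR : 0 < n%:R :> R by rewrite ltr0n.
have r0 : 0 <= r by rewrite (le_trans _ nr)// powR_ge0.
have cH : #|H|%:R + k%:R >= n%:R :> R.
  by rewrite -natrD ler_nat; move: nulls (cardsC H); rewrite card_ord; lia.
have Hn : #|H|%:R <= n%:R :> R by rewrite ler_nat (leq_trans (max_card _))// card_ord.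
apply: (le_trans (@chernoff_hits R n P indepP H A
  (1 / 2 + 5 / 4 * r) (n%:R / 2) (r / 4) mA _ _ _)).
- by rewrite divr_ge0.
- by have := r1; lra.
- by move=> i iH; rewrite HA// lee_fin.
have knr : k%:R <= n%:R * r by move: kr; rewrite ler_pdivrMr// mulrC.
rewrite lee_fin ler_expR; set h : R := #|H|%:R in cH Hn *.
have h1 : h * r >= 9 / 10 * n%:R * r by rewrite ler_wpM2r//; have := kn; lra.
have h2 : n%:R / 2 + 5 / 8 * n%:R * r <= h * (1 / 2 + 5 / 4 * r) by lra.
have h3 : r / 4 * (n%:R / 2 + 5 / 8 * n%:R * r) <= r / 4 * (h * (1 / 2 + 5 / 4 * r)).
  by rewrite ler_wpM2l//; lra.
have h4 : h * r ^+ 2 <= n%:R * r ^+ 2 by rewrite ler_wpM2r// exprn_ge0.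
have h5 : 0 <= n%:R * r ^+ 2 by rewrite mulr_ge0// exprn_ge0.
by lra.
Qed.

(** A median off by more than [d] leaves at most half of the observations, hence
    of the nulls, in a half-line that contains more than half of the null mass. *)
Lemma median_concentrates :
  (P [set y | (d < `|sample_median y - t|)%R] <= (expR (- (n%:R `^ (1 / 2))))%:E)%E.
Proof.
pose A (b : bool) := if b then `]-oo, t + d]%classic else `[t - d, +oo[%classic : set R.
have mA b : measurable (A b) by rewrite /A; case: b; exact: measurable_itv.
have HA b i : i \in H -> marginal P i (A b) = (Gbar g (- d))%:E.
  move=> /null_has_density h; case: b.
    by rewrite (null_marginal_le hg _ h); congr (Gbar g _)%:E; lra.
  by rewrite (null_marginal_ge hg _ h); congr (Gbar g _)%:E; lra.
have mn := uphalf_index n0.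
apply: (le_trans (@prob_le_sum _ _ _ P bool xpredT
  (fun b => [set y | (#|(H :&: hits (A b) y)%SET|%:R <= n%:R / 2 :> R)%R]) _ _ _ _)).
- exact: measurable_median_far.
- by move=> b; apply: (measurable_hits (fun S => #|(H :&: S)%SET|%:R <= n%:R / 2 :> R)).
- move=> y /= far.
  have half m : (m <= n./2)%N -> m%:R <= n%:R / 2 :> R.
    by move=> hm; rewrite ler_pdivlMr// -natrM ler_nat; lia.
  have [lt_t|t_le] := ltP (sample_median y) t.
  + exists false => //; apply: half.
    move: far; rewrite ltr0_norm ?subr_lt0// => far.
    have : sample_median y < t - d by lra.
    rewrite order_stat_lt// => many.
    have : (#|[set i | (tnth y i < t - d)%R]%SET| + #|(H :&: hits (A false) y)%SET| <= n)%N.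
      rewrite -[X in (_ <= X)%N]card_ord -cardsUI.
      rewrite [X in (_ + X)%N](_ : _ = 0)%N ?addn0 ?max_card//.
      apply: eq_card0 => i; apply/negP => /finset.setIP[]; rewrite inE => lt_i.
      move=> /finset.setIP[_]; rewrite inE => /asboolP.
      by rewrite /= in_itv/= andbT leNgt lt_i.
    move=> /(leq_trans (leq_add many (leqnn _))).
    by rewrite uphalf_half -[X in (_ <= X)%N](odd_double_half n) -addnn addnA leq_add2l.
  + exists true => //; apply: half.
    move: far; rewrite ger0_norm ?subr_ge0// => far.
    have : ~~ (sample_median y <= t + d) by rewrite -ltNge; lra.
    rewrite order_stat_le// -ltnNge uphalf_half => few.
    suff : (#|(H :&: hits (A true) y)%SET| <= #|[set i | (tnth y i <= t + d)%R]%SET|)%N.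
      move=> /leq_trans; apply; rewrite -ltnS (leq_trans few)//.
      by rewrite -add1n leq_add2r; case: (odd n).
    apply/subset_leq_card/fintype.subsetP => i /finset.setIP[_].
    rewrite finset.inE => /asboolP h.
    by rewrite finset.inE; move: h; rewrite /A/= in_itv.
apply: (@le_trans _ _ (\sum_(b : bool) (expR (- (n%:R * r ^+ 2 / 16)))%:E)%E).
  by apply: lee_sum => b _; apply: few_nulls_in_halfline => // i; exact: HA.
rewrite big_bool/= -EFinD lee_fin; apply: le_trans (two_expR_le n30 nr).
by lra.
Qed.

End Concentration.

(** * The two risks *)

Section Risks.
Context {R : realType} (g : R -> R).
Hypothesis hg : symmetric_unimodal_density g.
Context {n : nat} (P : probability (n.-tuple R) R).
Hypotheses (n0 : (0 < n)%N) (indepP : is_product P).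
Variables (alpha d e : R).
Hypotheses (a0 : 0 < alpha) (a1 : alpha < 1 / 2).
Hypotheses (d0 : 0 <= d) (e0 : 0 <= e) (e1 : e <= 5 / 100).
Hypothesis de : forall t, 95 / 100 * alpha / n%:R <= t <= alpha ->
  d * sensitivity g t <= e.

Local Notation t0 := (theta g P).
Local Notation G := (Gbar g).
Local Notation Ginv := (Gbar_inv g).
Local Notation med := (@sample_median R n).
Local Notation BHm := (@BH R n g alpha sample_median).
Local Notation far := [set y : n.-tuple R | d < `|med y - t0|].

Let nR : 0 < n%:R :> R. Proof. by rewrite ltr0n. Qed.
Let alpha1 : alpha <= 1. Proof. by move: a1 => h; lra. Qed.

Lemma measurable_fun_BH beta u (h : {set 'I_n} -> R) : 0 < beta -> beta <= 1 ->
  measurable_fun setT u ->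
  measurable_fun setT (fun y : n.-tuple R => h (BH g beta u y)).
Proof.
move=> b0 b1 mu _ Y mY; rewrite setTI.
exact: (@measurable_BH R n g beta u (fun S => Y (h S))).
Qed.

Lemma TDP_mono (S S' : {set 'I_n}) : S \subset S' -> TDP g P S <= TDP g P S'.
Proof.
move=> SS; rewrite /TDP ler_wpM2r ?invr_ge0// ler_nat.
by apply/subset_leq_card/finset.setSI.
Qed.

(** Moving the center turns a p-value at most [t] into one at most [t * (1 + e)],
    and [(1 - e) * (1 + e) <= 1]. *)
Lemma oracle_subset y : `|med y - t0| <= d ->
  BH_oracle g P (alpha * (1 - e)) y \subset BHm y.
Proof.
move=> close.
have ae : alpha * e <= alpha * (5 / 100) by rewrite ler_wpM2l// ltW.
have ae0 : 0 <= alpha * e by rewrite mulr_ge0// ltW.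
have a0' := a0; have a1' := a1; have e0' := e0; have e1' := e1.
apply: (@rejected_subset R n n0 alpha (alpha * (1 - e)) e) => //; try lra.
  have : 0 <= alpha * (e * e) by rewrite !mulr_ge0// ltW.
  by lra.
move=> i t /andP[t1 t2].
have tn : 95 / 100 * alpha / n%:R <= t.
  by rewrite (le_trans _ t1)// ler_wpM2r ?invr_ge0 ?(ltW nR)//; lra.
have tp : 0 < t by rewrite (lt_le_trans _ tn)// divr_gt0// mulr_gt0.
apply: (@pvalue_shift R g hg t d e) => //; try lra.
- by apply: de; rewrite tn/=; lra.
- rewrite lerBlDr; have := ler_normD (tnth y i - med y) (med y - t0).
  by rewrite addrA subrK; lra.
Qed.

Lemma risk_II_bound : (P [set y | (TDP g P (BHm y)
    < TDP g P (BH_oracle g P (alpha * (1 - e)) y))%R] <= P far)%E.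
Proof.
have b0 : 0 < alpha * (1 - e) by rewrite mulr_gt0//; have := e1; lra.
have b1 : alpha * (1 - e) <= 1.
  have h : 0 <= alpha * e by rewrite mulr_ge0// ltW.
  by have := alpha1; lra.
have mmed : measurable_fun setT med := measurable_median n0.
apply: le_measure.
- rewrite inE (_ : [set y | _] = ~` [set y | TDP g P (BH_oracle g P (alpha * (1 - e)) y)
      - TDP g P (BHm y) <= 0]).
    apply/measurableC/measurable_ray_preimage.
    apply: measurable_funB; first by apply: measurable_fun_BH => //; exact: measurable_cst.
    exact: measurable_fun_BH.
  by apply/seteqP; split=> y /=; rewrite subr_le0 ltNge => /negP.
- by rewrite inE; exact: measurable_median_far.
- move=> y /=; apply: contraTT; rewrite -!leNgt => close.
  exact/TDP_mono/oracle_subset.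
Qed.

(** Level of the step-up procedure with [r] rejections, and the corresponding
    critical distance to the center. *)
Let lev (r : nat) : R := alpha * r%:R / n%:R.
Let crit (r : nat) : R := Ginv (lev r / 2).

(** The half-line where a null observation on side [b] falls when it is rejected
    among [r], given a center within [d] of the true one. *)
Let tail_set (b : bool) (r : nat) : set R :=
  if b then `[t0 + (crit r - d), +oo[%classic else `]-oo, t0 - (crit r - d)]%classic.

(** An observation frozen there is rejected for all centers within [d] of the
    true one, whatever the others are. *)
Let extreme (b : bool) : R := if b then t0 + (d + crit 1) else t0 - (d + crit 1).

Let lev_bounds (r : nat) : (0 < r)%N -> (r <= n)%N ->
  [/\ 0 < lev r, lev r < 1 / 2 & 95 / 100 * alpha / n%:R <= lev r <= alpha].
Proof.
move=> r0 rn; have r1 : 1 <= r%:R :> R by rewrite ler1n.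
have a0' := a0; have a1' := a1.
have la : lev r <= alpha by rewrite ler_pdivrMr// ler_wpM2l ?(ltW a0)// ler_nat.
have al : 95 / 100 * alpha / n%:R <= lev r.
  rewrite ler_wpM2r ?invr_ge0 ?(ltW nR)//.
  have : alpha * 1 <= alpha * r%:R by rewrite ler_wpM2l// ltW.
  by lra.
split; [by rewrite divr_gt0// mulr_gt0// ltr0n | lra | by rewrite al].
Qed.

Lemma measurable_tail_set b r : measurable (tail_set b r).
Proof. by rewrite /tail_set; case: b; exact: measurable_itv. Qed.

Lemma null_tail_prob b r i : i \in H0 g P -> (0 < r)%N -> (r <= n)%N ->
  (marginal P i (tail_set b r) <= (lev r / 2 * (1 + e))%:E)%E.
Proof.
move=> /null_has_density dens r0 rn; have [l0 l1 lI] := lev_bounds r0 rn.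
have dl := de lI; have e1' := e1.
have h := Gbar_shifted_quantile hg l0 l1 d0 (le_trans dl (ltac:(lra) : e <= 1)).
have -> : marginal P i (tail_set b r) = (G (crit r - d))%:E.
  rewrite /tail_set; case: b.
    by rewrite (null_marginal_ge hg _ dens); congr (G _)%:E; lra.
  by rewrite (null_marginal_le hg _ dens); congr (G _)%:E; lra.
rewrite lee_fin (le_trans h)// ler_wpM2l ?lerD2l//; lra.
Qed.

Let decoupled (i : 'I_n) (b : bool) (r : nat) : set (n.-tuple R) :=
  [set y | #|BHm (subst_coord i (extreme b) y)| = r] `&`
  [set y | tail_set b r (tnth y i)].

(** The rejected observation and the extreme value lie on the same side of the
    median, and the p-values of both are below the threshold: neither the median
    nor the rejections notice the exchange. *)
Lemma rejection_decouples y i : `|med y - t0| <= d -> i \in BHm y ->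
  exists b, decoupled i b #|BHm y| y.
Proof.
move=> close iR; set r := #|BHm y|.
have r0 : (0 < r)%N by apply/card_gt0P; exists i.
have rn : (r <= n)%N by rewrite (leq_trans (max_card _))// card_ord.
have [l0 l1 lI] := lev_bounds r0 rn.
have [k0 k1 kI] := lev_bounds (ltn0Sn 0) n0.
have mn := uphalf_index n0.
have pr : pval g (med y) y i <= lev r.
  exact: (@rejected_le R n n0 alpha (pval g (med y) y) i a0 alpha1 iR).
have out : crit r <= `|tnth y i - med y|.
  by apply: Gbar_le_inv => //; move: pr; rewrite /pval; lra.
have pos s : 0 < lev s -> lev s < 1 / 2 -> 0 < crit s.
  by move=> s0 s1; have [y0 yx _ _ _] := quantile_gap hg s0 s1; exact: le_lt_trans yx.
have critr := pos _ l0 l1; have crit1 := pos _ k0 k1.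
have same c : med (subst_coord i c y) = med y -> crit 1 <= `|c - med y| ->
    BHm (subst_coord i c y) = BHm y.
  move=> mc cc.
  have := @rejected_perturb R n n0 alpha (pval g (med y) y)
    (pval g (med y) (subst_coord i c y)) i a0 alpha1 iR.
  rewrite /BH /BH_threshold mc => h; apply: h.
    rewrite /pval tnth_subst eqxx; have := Gbar_anti hg cc.
    have -> : G (crit 1) = lev 1 / 2 by rewrite Gbar_invK//; lra.
    by rewrite (_ : lev 1 = alpha / n%:R) ?/lev ?mulr1//; lra.
  by move=> j ji; rewrite /pval tnth_subst (negbTE ji).
move: close; rewrite ler_norml => /andP[c1 c2].
have [ge_m|lt_m] := leP (med y) (tnth y i); [exists true|exists false].
- have {}out : crit r <= tnth y i - med y by rewrite -[leRHS]ger0_norm ?subr_ge0.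
  have tail : tail_set true r (tnth y i) by rewrite /tail_set/= in_itv/= andbT; lra.
  split; last exact: tail.
  rewrite /mkset same; [reflexivity| |by rewrite /extreme ger0_norm; lra].
  by apply: order_stat_subst_gt; rewrite -/(sample_median y);
    [exact: mn|lra|rewrite /extreme; lra].
- have {}out : crit r <= - (tnth y i - med y).
    by rewrite -[leRHS]ltr0_norm ?subr_lt0.
  have tail : tail_set false r (tnth y i) by rewrite /tail_set/= in_itv/=; lra.
  split; last exact: tail.
  rewrite /mkset same; [reflexivity| |by rewrite /extreme ler0_norm; lra].
  by apply: order_stat_subst_lt; rewrite -/(sample_median y);
    [exact: mn|lra|rewrite /extreme; lra].
Qed.

Let weight (i : 'I_n) (r : nat) : R :=
  if (i \in H0 g P) && (0 < r)%N then r%:R^-1 else 0.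

Lemma weight_ge0 i r : 0 <= weight i r.
Proof. by rewrite /weight; case: ifP => // _; rewrite invr_ge0. Qed.

(** Off the exceptional event, each rejected null contributes one over the number
    of rejections, through one of its decoupled events. *)
Lemma FDP_decomposition y : FDP g P (BHm y) <=
  \1_far y + \sum_(p : 'I_n * (bool * 'I_n.+1))
    weight p.1 p.2.2 * \1_(decoupled p.1 p.2.1 p.2.2) y.
Proof.
have S0 : 0 <= \sum_(p : 'I_n * (bool * 'I_n.+1))
    weight p.1 p.2.2 * \1_(decoupled p.1 p.2.1 p.2.2) y.
  by apply: sumr_ge0 => p _; rewrite mulr_ge0// weight_ge0.
rewrite indicE; case: (boolP (y \in far)) => [_|].
  apply: (@le_trans _ _ 1); last by rewrite lerDl.
  rewrite /FDP ler_pdivrMr ?ltr0n ?leq_max ?orbT// mul1r ler_nat leq_max.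
  by rewrite subset_leq_card// finset.subsetIl.
rewrite notin_setE /= => /negP; rewrite -leNgt => close; rewrite add0r.
rewrite -(pair_bigA _ (fun i (q : bool * 'I_n.+1) =>
  weight i q.2 * \1_(decoupled i q.1 q.2) y))/=.
rewrite /FDP mulr_natl -sumr_const big_mkcond; apply: ler_sum => i _.
case: ifP => [/finset.setIP[iR iH]|_]; last first.
  by apply: sumr_ge0 => q _; rewrite mulr_ge0// weight_ge0.
have [b sb] := rejection_decouples close iR.
have r0 : (0 < #|BHm y|)%N by apply/card_gt0P; exists i.
have rn : (#|BHm y| < n.+1)%N by rewrite ltnS (leq_trans (max_card _))// card_ord.
rewrite (bigD1 (b, Ordinal rn))//= /weight iH r0/= indicE mem_set// mulr1.
rewrite (maxn_idPl r0) lerDl; apply: sumr_ge0 => q _.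
by rewrite mulr_ge0//; case: ifP => // _; rewrite invr_ge0.
Qed.

Lemma measurable_count_subst i c r :
  measurable [set y | #|BHm (subst_coord i c y)| = r].
Proof.
rewrite -[X in measurable X]setTI.
apply: (measurable_subst i c measurableT (Y := [set z | #|BHm z| = r])).
apply: (@measurable_BH R n g alpha sample_median (fun S => #|S| = r)) => //.
exact: measurable_median.
Qed.

Lemma sum_prob_count_subst i c :
  (\sum_(r < n.+1) P [set y | #|BHm (subst_coord i c y)| = r] <= 1)%E.
Proof.
rewrite -measure_semi_additive_ord//.
- by apply: probability_le1; apply: bigsetU_measurable => r _; exact: measurable_count_subst.
- by move=> r; exact: measurable_count_subst.
- by move=> r s _ _ [y [hr hs]]; apply/val_inj; exact: etrans (esym hr) hs.
- by apply: bigsetU_measurable => r _; exact: measurable_count_subst.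
Qed.

(** One observation on one side: by independence the frozen rejection count and
    the tail event factorize, the weight [1 / r] cancels the [r] of the level,
    and the counts are exclusive. *)
Lemma side_contribution i b :
  (\sum_(r < n.+1) (weight i r)%:E * P (decoupled i b r) <=
   (alpha / (2 * n%:R) * (1 + e))%:E)%E.
Proof.
set K := alpha / _ * _.
have K0 : 0 <= K by rewrite mulr_ge0 ?divr_ge0 ?mulr_ge0 ?addr_ge0// ltW.
apply: (@le_trans _ _ (\sum_(r < n.+1)
  (K%:E * P [set y | #|BHm (subst_coord i (extreme b) y)| = r]))%E); last first.
  rewrite -ge0_sume_distrr; last by move=> r _; exact: measure_ge0.
  by rewrite -[leRHS]mule1 lee_wpmul2l ?lee_fin//; exact: sum_prob_count_subst.
apply: lee_sum => r _; rewrite /weight.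
case: ifP => [/andP[iH r0]|_]; last by rewrite mul0e mule_ge0.
have mC : measurable [set z | #|BHm z| = r].
  apply: (@measurable_BH R n g alpha sample_median (fun S => #|S| = r)) => //.
  exact: measurable_median.
rewrite /decoupled (indep_subst indepP _ _ (measurable_tail_set b r) mC).
rewrite muleCA [leLHS]muleC; apply: lee_wpmul2r; first exact: measure_ge0.
have rn : (r <= n)%N by rewrite -ltnS.
have := null_tail_prob b iH r0 rn.
have rR : 0 < r%:R :> R by rewrite ltr0n.
move=> /(lee_wpmul2l (_ : (0 <= (r%:R^-1)%:E)%E)) h.
apply: (le_trans (h _)); first by rewrite lee_fin invr_ge0 ltW.
rewrite -EFinM lee_fin /K /lev le_eqVlt; apply/orP; left; apply/eqP.
by field; rewrite !gt_eqF.
Qed.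

Lemma FDR_bound : (FDR g P BHm <= (alpha * (1 + e))%:E + P far)%E.
Proof.
have mmed : measurable_fun setT med := measurable_median n0.
apply: (le_trans (@expectation_le_simple R _ _ P _
  (fun p : 'I_n * (bool * 'I_n.+1) => weight p.1 p.2.2)
  (fun p => decoupled p.1 p.2.1 p.2.2) far _ _ _ _ _ _ FDP_decomposition)).
- exact: (measurable_fun_BH (FDP g P)).
- by move=> y; rewrite divr_ge0.
- by move=> p; exact: weight_ge0.
- exact: measurable_median_far.
- move=> p; apply: measurableI; first exact: measurable_count_subst.
  by apply: measurable_coord; exact: measurable_tail_set.
rewrite addeC; apply: leeD2r.
rewrite -(pair_bigA _ (fun i (q : bool * 'I_n.+1) =>
  (weight i q.2)%:E * P (decoupled i q.1 q.2)))%E/=.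
apply: (@le_trans _ _ (\sum_(i < n) \sum_(b : bool) (alpha / (2 * n%:R) * (1 + e))%:E)%E).
  apply: lee_sum => i _.
  rewrite -(pair_bigA _ (fun (b : bool) (r : 'I_n.+1) =>
    (weight i r)%:E * P (decoupled i b r)))%E/=.
  by apply: lee_sum => b _; exact: side_contribution.
under eq_bigr do rewrite sumEFin.
rewrite sumEFin lee_fin !sumr_const card_bool card_ord -mulrnA.
rewrite -[X in X <= _]mulr_natl natrM le_eqVlt; apply/orP; left; apply/eqP.
by field; rewrite gt_eqF.
Qed.

End Risks.

Theorem theorem5p3 (R : realType) (g : R -> R)
  (hg : symmetric_unimodal_density g) :
  exists c1 c2 : R, [/\ 0 < c1, 0 < c2 &
    forall (n : nat) (alpha : R), c1 <= n%:R -> 0 < alpha < 1 / 2 ->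
    forall k : nat, k%:R <= 1 / 10 * n%:R :> R ->
    let eta := eta_of c2 g n k alpha in
    eta <= 5 / 100 ->
    (risk_I g (BH (n := n) g alpha sample_median) k
       <= (alpha * (1 + eta) + expR (- (n%:R `^ (1 / 2))))%:E)%E /\
    (risk_II g (BH (n := n) g alpha sample_median) k (alpha * (1 - eta))
       <= (expR (- (n%:R `^ (1 / 2))))%:E)%E].
Proof.
have [c2 c2_gt0 gain] := Gbar_linear_gain hg.
(* [2 ^ 30 = 32 ^ 6], so that [n^(1/6)] is at least [32]. *)
exists (2 ^+ 30), c2; split; [by rewrite exprn_gt0|by []|].
move=> n alpha n30 /andP[a0 a1] k kn eta eta_small.
have n0 : (0 < n)%N by rewrite -(ltr0n R) (lt_le_trans _ n30)// exprn_gt0.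
have nR : 0 < n%:R :> R by rewrite ltr0n.
set r : R := Num.max (k%:R / n%:R) (n%:R `^ (- (1 / 6))).
have kr : k%:R / n%:R <= r by rewrite le_max lexx.
have nr : n%:R `^ (- (1 / 6)) <= r by rewrite le_max lexx orbT.
have r0 : 0 <= r by rewrite (le_trans _ nr)// powR_ge0.
have r1 : r <= 1 / 10.
  rewrite ge_max ler_pdivrMr// kn/=.
  by have := root6_le n30; lra.
set d := c2 * r.
have d0 : 0 <= d by rewrite mulr_ge0// ltW.
have deta t : 95 / 100 * alpha / n%:R <= t <= alpha -> d * sensitivity g t <= eta.
  exact: eta_of_sensitivity.
(* At [t = alpha] the bound [deta] has a nonnegative left side. *)
have eta0 : 0 <= eta.
  apply: le_trans (deta alpha _); first by rewrite mulr_ge0// sensitivity_ge0.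
  rewrite lexx andbT ler_pdivrMr// mulrC ler_wpM2l ?(ltW a0)//.
  by apply: (@le_trans _ _ 1); [lra | rewrite ler1n].
have far (P : probability (n.-tuple R) R) : in_Pg g P -> (n1 g P <= k)%N ->
    (P [set y | (d < `|sample_median y - theta g P|)%R]
      <= (expR (- (n%:R `^ (1 / 2))))%:E)%E.
  move=> [indepP _] nulls.
  exact: (median_concentrates hg indepP n30 nulls kn kr nr r1 (gain r r0 r1)).
split; apply: ge_ereal_sup => _ [P [/= inP nulls] <-]; have [indepP _] := inP.
- rewrite EFinD.
  apply: (le_trans (@FDR_bound R g hg n P n0 indepP alpha d eta _ _ _ _ _ _)) => //.
  by rewrite leeD2l// far.
- apply: (le_trans (@risk_II_bound R g hg n P n0 alpha d eta _ _ _ _ _ _)) => //.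
  exact: far.
Qed.
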